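(* Let $\beta,\gamma\in\mathbf{R}$ satisfy $\beta<\frac12$, $\beta+\delta\leq1$, $\gamma+\beta<1$ and $\delta+\gamma\leq1$. Given $u_0$, set $\eta_1(t)=\mathrm{e}^{tA}u_0$ and $\eta_2=\mathcal{V}(\eta_1,\eta_1)$, and assume that $$\|\eta_1\|_{\alpha,\gamma,T}\to0\quad\text{and}\quad\|\eta_2\|_{\alpha,\beta,T}\to0\qquad\text{as }T\to0.$$ Then there is $T>0$ such that the problem $$v=\mathcal{V}(v,v)+2\mathcal{V}(v,\eta_1)+\eta_2$$ has a unique fixed point (solution) $v$ in $\mathscr{X}^{\alpha,\beta}_T$.
   Context: Functions and distributions are on the $d$-dimensional torus $\mathbb{T}^d$. For $\alpha\in\mathbf{R}$, $\mathscr{C}^\alpha=B^\alpha_{\infty,\infty}(\mathbb{T}^d)$ is the closure of smooth periodic functions in the norm $\|u\|_\alpha=\sup_{j\geq-1}2^{j\alpha}\|\Delta_j u\|_{L^\infty}$, where $\Delta_j$ are the Littlewood--Paley blocks associated with a smooth dyadic partition of unity. $A$ is an unbounded linear operator generating an analytic semigroup $(\mathrm{e}^{tA})_{t\geq0}$, and there is $\tau>0$ such that $\|\mathrm{e}^{tA}u\|_{\alpha'+\beta'}\leq c\,t^{-\beta'/\tau}\|u\|_{\alpha'}$ for every $\alpha'\in\mathbf{R}$, $u\in B^{\alpha'}_{\infty,\infty}$ and $\beta'\geq0$. $B$ is a symmetric bilinear operator. Set $$\mathcal{V}(u_1,u_2)(t)=\int_0^t \mathrm{e}^{(t-s)A}B(u_1(s),u_2(s))\,ds.$$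 Standing assumption on the nonlinearity: there are $\alpha\in\mathbf{R}$, $\delta\in[0,1)$ and $c>0$ (fixed from now on) such that $$\|\mathcal{V}(u_1,u_2)(t)\|_\alpha\leq c\int_0^t(t-s)^{-\delta}\|u_1(s)\|_\alpha\|u_2(s)\|_\alpha\,ds .$$ For $\beta\in\mathbf{R}$ (negative values are allowed) and $T>0$, $\mathscr{X}^{\alpha,\beta}_T$ is the normed space of functions $u$ of time with values in $\mathscr{C}^\alpha$ such that $\|u\|_{\alpha,\beta,T}=\sup_{t\in[0,T]}t^\beta\|u(t)\|_\alpha<\infty$ (the supremum being understood over $t\in(0,T]$, since functions may be singular at $t=0$).
   Formalization: When β+δ=1, uniqueness in all of X^{α,β}_T fails (a nonzero solution can exist for u_0=0); there it is claimed only among solutions whose norm on some initial interval (0,T'] is at most a fixed ε>0. When β+δ<1, uniqueness is in all of X^{α,β}_T. *)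

(* Defs.v *)
From HB Require Import structures.
From mathcomp Require Import all_boot all_order all_algebra.
From mathcomp Require Import all_classical all_reals all_analysis.
From mathcomp Require Import complex.

Set Implicit Arguments.
Unset Strict Implicit.
Unset Printing Implicit Defensive.

Import Order.TTheory GRing.Theory Num.Theory.
Import numFieldNormedType.Exports.

Local Open Scope classical_set_scope.
Local Open Scope ring_scope.

(* Functions and distributions on the torus T^d = (R / 2 pi Z)^d are complex
   valued and are represented by their Fourier coefficients:
   u : 'rV[int]_d -> R[i] stands for the formal series
   \sum_(k in Z^d) u k * e^{i k.x}, which is a distribution iff its
   coefficients grow at most polynomially, and a smooth function iff they
   decay faster than every power of |k|. *)
Notation fourier R d := ('rV[int]_d -> R[i]).

Notation cabs := ComplexField.Normc.normc.

Section torus.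
Variables (R : realType) (d : nat).

Definition enorm (x : 'rV[R]_d) : R := Num.sqrt (\sum_(i < d) x 0 i ^+ 2).

Definition freq (k : 'rV[int]_d) : 'rV[R]_d := \row_i (k 0 i)%:~R.

Definition character (k : 'rV[int]_d) (x : 'rV[R]_d) : R[i] :=
  let y := \sum_(i < d) (k 0 i)%:~R * x 0 i in (cos y +i* sin y)%C.

Definition periodic_distribution (u : fourier R d) : Prop :=
  exists C : R, exists N : nat,
    forall k, cabs (u k) <= C * (1 + enorm (freq k)) ^+ N.

Definition smooth_periodic (u : fourier R d) : Prop :=
  forall N : nat, exists C : R,
    forall k, cabs (u k) <= C * (1 + enorm (freq k)) ^- N.

Definition partials (s : seq 'I_d) (f : 'rV[R]_d -> R) : 'rV[R]_d -> R :=
  foldr (fun i g => fun x => 'D_(delta_mx 0 i : 'rV[R]_d) g x) f s.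

Definition smooth (f : 'rV[R]_d -> R) : Prop :=
  forall s : seq 'I_d, continuous (partials s f) /\
    forall (i : 'I_d) x, derivable (partials s f) x (delta_mx 0 i : 'rV[R]_d).

Record dyadic_partition (chi rho : 'rV[R]_d -> R) : Prop := DyadicPartition {
  dp_smooth : smooth chi /\ smooth rho;
  dp_ge0 : forall x, 0 <= chi x /\ 0 <= rho x;
  dp_radial : forall x y, enorm x = enorm y -> chi x = chi y /\ rho x = rho y;
  dp_ball : exists r : R, forall x, chi x != 0 -> enorm x <= r;
  dp_annulus : exists a b : R,
    0 < a /\ forall x, rho x != 0 -> a <= enorm x <= b;
  dp_sum : forall x : 'rV[R]_d,
    series (fun j => rho ((2 ^- j : R) *: x)) @ \oo --> 1 - chi x;
  dp_disjoint_ball : forall (j : nat) (x : 'rV[R]_d),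
    (1 <= j)%N -> chi x * rho ((2 ^- j : R) *: x) = 0;
  dp_disjoint_annuli : forall (i j : nat) (x : 'rV[R]_d), (i + 2 <= j)%N ->
    rho ((2 ^- i : R) *: x) * rho ((2 ^- j : R) *: x) = 0 }.

Section besov.
Variables chi rho : 'rV[R]_d -> R.

(* The index is shifted by one: [lp_block j] is the block Delta_{j-1}. *)
Definition lp_symbol (j : nat) (x : 'rV[R]_d) : R :=
  if j is i.+1 then rho ((2 ^- i : R) *: x) else chi x.

(* A finite sum, the symbol being compactly supported. *)
Definition lp_block (j : nat) (u : fourier R d) (x : 'rV[R]_d) : R[i] :=
  \sum_(k \in [set: 'rV[int]_d])
    ((lp_symbol j (freq k))%:C)%C * u k * character k x.

Definition linf_norm (f : 'rV[R]_d -> R[i]) : \bar R :=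
  ereal_sup (range (fun x => (cabs (f x))%:E)).

Definition besov_norm (a : R) (u : fourier R d) : \bar R :=
  ereal_sup (range (fun j : nat =>
    ((2 `^ ((j%:R - 1) * a))%:E * linf_norm (lp_block j u))%E)).

Local Arguments besov_norm (a u)%_ring_scope.

Definition besov (a : R) : set (fourier R d) :=
  [set u | periodic_distribution u /\ (besov_norm a u < +oo)%E].

Definition holder (a : R) : set (fourier R d) :=
  [set u | besov a u /\
    forall e : R, 0 < e ->
      exists2 f, smooth_periodic f & (besov_norm a (u - f) <= e%:E)%E].

Definition linear_on (E : set (fourier R d))
    (L : fourier R d -> fourier R d) : Prop :=
  forall (z : R[i]) u v, E u -> E v -> L (z \*o u + v) = z \*o L u + L v.

Definition sector (m : R) : set R[i] :=
  [set z | 0 < complex.Re z /\ `|complex.Im z| < m * complex.Re z].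

(* [Sz] is an analytic semigroup in a sector on the Banach space C^a. *)
Definition analytic_semigroup (a m : R)
    (Sz : R[i] -> fourier R d -> fourier R d) : Prop :=
  [/\ forall z, sector m z ->
        [/\ forall u, holder a u -> holder a (Sz z u),
            linear_on (holder a) (Sz z) &
            exists C : R, forall u, holder a u ->
              (besov_norm a (Sz z u) <= C%:E * besov_norm a u)%E],
      forall u, holder a u -> Sz 0 u = u,
      forall z w u, sector m z -> sector m w -> holder a u ->
        Sz (z + w) u = Sz z (Sz w u),
      forall u, holder a u -> forall e : R, 0 < e -> exists2 r : R, 0 < r &
        forall z, sector m z -> cabs z < r ->
          (besov_norm a (Sz z u - u) <= e%:E)%E &
      forall u z, holder a u -> sector m z ->
        exists2 D, holder a D &
          forall e : R, 0 < e -> exists2 r : R, 0 < r &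
            forall h, cabs h < r ->
              (besov_norm a (Sz (z + h)%R u - Sz z u - h \*o D)
                 <= (e * cabs h)%:E)%E].

(* The operator A with domain DA is the infinitesimal generator, in C^a, of
   the analytic semigroup (S t)_{t >= 0}. *)
Definition generates_analytic_semigroup (a : R) (DA : set (fourier R d))
    (A : fourier R d -> fourier R d)
    (S : R -> fourier R d -> fourier R d) : Prop :=
  [/\ exists m : R, exists Sz,
        [/\ 0 < m, analytic_semigroup a m Sz &
            forall (t : R) u, 0 <= t -> holder a u -> S t u = Sz (t%:C)%C u],
      forall u, DA u -> holder a u /\ holder a (A u),
      forall (z : R[i]) u v, DA u -> DA v -> DA (z \*o u + v),
      linear_on DA A &
      forall u f, holder a u -> holder a f ->
        (DA u /\ A u = f) <->
        besov_norm a (((t^-1)%:C)%C \*o (S t u - u) - f) @[t --> 0^'+]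
          --> 0%E].

(* e^{tA} acts consistently on all distributions, and not only on the space
   on which A generates it. *)
Definition distribution_semigroup
    (S : R -> fourier R d -> fourier R d) : Prop :=
  [/\ forall (t : R) u, 0 <= t ->
        periodic_distribution u -> periodic_distribution (S t u),
      forall t : R, 0 <= t -> linear_on periodic_distribution (S t),
      forall u, periodic_distribution u -> S 0 u = u &
      forall (s t : R) u, 0 <= s -> 0 <= t -> periodic_distribution u ->
        S (s + t) u = S s (S t u)].

Definition smoothing (tau : R)
    (S : R -> fourier R d -> fourier R d) : Prop :=
  forall a b : R, 0 <= b -> exists c : R, forall (t : R) u, 0 < t -> besov a u ->
    (besov_norm (a + b) (S t u)
       <= (c * t `^ (- b / tau))%:E * besov_norm a u)%E.

Definition symmetric_bilinear_on (E : set (fourier R d))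
    (B : fourier R d -> fourier R d -> fourier R d) : Prop :=
  [/\ forall u v, E u -> E v -> periodic_distribution (B u v),
      forall u v, E u -> E v -> B u v = B v u &
      forall w, E w -> linear_on E (fun u => B u w)].

(* The time integral of a distribution valued function is taken weakly, that
   is, on each Fourier coefficient. *)
Definition duhamel_integrable (S : R -> fourier R d -> fourier R d)
    (B : fourier R d -> fourier R d -> fourier R d)
    (u1 u2 : R -> fourier R d) (t : R) : Prop :=
  forall k,
    lebesgue_measure.-integrable `]0, t[
      (fun s => (complex.Re (S (t - s) (B (u1 s) (u2 s)) k))%:E) /\
    lebesgue_measure.-integrable `]0, t[
      (fun s => (complex.Im (S (t - s) (B (u1 s) (u2 s)) k))%:E).

Definition duhamel (S : R -> fourier R d -> fourier R d)
    (B : fourier R d -> fourier R d -> fourier R d)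
    (u1 u2 : R -> fourier R d) (t : R) : fourier R d :=
  fun k =>
    ((\int[lebesgue_measure]_(s in `]0%R, t[)
        complex.Re (S (t - s) (B (u1 s) (u2 s)) k)) +i*
     (\int[lebesgue_measure]_(s in `]0%R, t[)
        complex.Im (S (t - s) (B (u1 s) (u2 s)) k)))%C.

(* Measurable functions of time in ]0, T] with values in C^a; as C^a is
   separable, measurability of the Fourier coefficients amounts to strong
   measurability. *)
Definition holder_path (a T : R) (u : R -> fourier R d) : Prop :=
  [/\ forall t : R, 0 < t <= T -> holder a (u t),
      forall k, measurable_fun `]0, T] (fun t => complex.Re (u t k)) &
      forall k, measurable_fun `]0, T] (fun t => complex.Im (u t k))].

Definition duhamel_bound (a delta c : R)
    (S : R -> fourier R d -> fourier R d)
    (B : fourier R d -> fourier R d -> fourier R d) : Prop :=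
  forall u1 u2 (t : R), 0 < t -> holder_path a t u1 -> holder_path a t u2 ->
    let I := (\int[lebesgue_measure]_(s in `]0%R, t[)
      (((t - s) `^ (- delta))%:E *
        (besov_norm a (u1 s) * besov_norm a (u2 s))))%E in
    (I < +oo)%E ->
    [/\ duhamel_integrable S B u1 u2 t,
        holder a (duhamel S B u1 u2 t) &
        (besov_norm a (duhamel S B u1 u2 t) <= c%:E * I)%E].

Definition path_norm (a b T : R) (u : R -> fourier R d) : \bar R :=
  ereal_sup [set ((t `^ b)%:E * besov_norm a (u t))%E | t in `]0, T]].

Definition path_space (a b T : R) : set (R -> fourier R d) :=
  [set u | holder_path a T u /\ (path_norm a b T u < +oo)%E].

Definition path_vanishing (a b : R) (u : R -> fourier R d) : Prop :=
  (\forall T \near (0 : R)^'+, path_space a b T u) /\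
  path_norm a b T u @[T --> (0 : R)^'+] --> 0%E.

Definition solves (S : R -> fourier R d -> fourier R d)
    (B : fourier R d -> fourier R d -> fourier R d)
    (eta1 eta2 : R -> fourier R d) (T : R) (v : R -> fourier R d) : Prop :=
  forall t : R, 0 < t <= T ->
    v t = duhamel S B v v t + 2 \*o duhamel S B v eta1 t + eta2 t.

End besov.
End torus.

(* Main.v *)
(* Bilinearity turns the difference of the Duhamel terms of u
   and w into V(u - w, u) + V(u - w, w) + 2 V(u - w, eta_1), and the Beta integral of
   (t - s)^-delta s^-theta, finite for theta = 2 beta and theta = beta + gamma, makes
   the right-hand side a contraction of a small ball of X^{alpha,beta}_T. Picard
   iteration gives the solution; two solutions agree near 0 by the contraction
   estimate, and then on ]0, T] by steps whose length depends only on their bounds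
   away from 0.

   Two points are not formal. First, completeness and separation of C^alpha rest on
   the bound |u_k| <= C (1 + |k|)^-alpha ||u||_alpha for Fourier coefficients, obtained
   by averaging a Littlewood-Paley block over translations that kill its other
   frequencies. Secondly, V(u, v) must be shown to be measurable in time: e^{(t-s)A}
   smooths distributions, so the integrand is right continuous in t and measurable
   in s, hence jointly measurable, and Fubini's theorem applies. *)

Require Import Defs.
From HB Require Import structures.
From mathcomp Require Import all_boot all_order all_algebra.
From mathcomp Require Import all_classical all_reals all_analysis.
From mathcomp Require Import measurable_realfun complex.
From mathcomp Require Import ring lra.

Set Implicit Arguments.
Unset Strict Implicit.
Unset Printing Implicit Defensive.

Import Order.TTheory GRing.Theory Num.Theory.
Import numFieldNormedType.Exports.

Local Open Scope classical_set_scope.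
Local Open Scope ring_scope.

Local Arguments besov_norm {R d} chi rho (a u)%_ring_scope.

(** * Trigonometric polynomials *)

Section complex_modulus.
Variable R : realType.
Implicit Types z w : R[i].

(** The space X^{alpha,beta}_T is never made into a complete metric space. Bounds are kept pointwise
    in time, as M t^(-b); the limit of the iterates is taken on each Fourier coefficient, and lower
    semicontinuity of the Besov norm carries the bounds over to it. Measurability is part of every
    induction because the assumption on V speaks of measurable paths: V(v, v) must be one before it
    can be fed to V again.

    The exponents enter in two ways. The conditions 2 beta < 1 and beta + gamma < 1 make the kernels
    integrable at s = 0, while beta + delta <= 1 and delta + gamma <= 1 make the powers of t that
    remain after factoring out t^(-beta) nonnegative. When beta + delta = 1 the power in the
    quadratic term is t^0 and shortening the time interval gains nothing: the contraction must come
    from the radius epsilon of the ball, and a competitor that is large near 0 escapes the estimate.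
    This is why uniqueness then asks for a small norm on some initial interval; when beta + delta <
    1, shrinking the interval handles any norm. *)

Lemma cabs_ge0 z : 0 <= cabs z.
Proof. by case: z => a b; exact: sqrtr_ge0. Qed.

Lemma cabsM z w : cabs (z * w) = cabs z * cabs w.
Proof. exact: ComplexField.Normc.normcM. Qed.

Lemma cabsD z w : cabs (z + w) <= cabs z + cabs w.
Proof. exact: le_normcD. Qed.

Lemma cabsN z : cabs (- z) = cabs z.
Proof. exact: normcN. Qed.

Lemma cabsB z w : cabs (z - w) = cabs (w - z).
Proof. by rewrite -cabsN opprB. Qed.

Lemma cabs0 : cabs (0 : R[i]) = 0.
Proof. exact: ComplexField.Normc.normc0. Qed.

Lemma cabs1 : cabs (1 : R[i]) = 1.
Proof. exact: ComplexField.Normc.normc1. Qed.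

Lemma cabsR (a : R) : cabs (a%:C)%C = `|a|.
Proof. by rewrite /= expr0n/= addr0 sqrtr_sqr. Qed.

Lemma Re_le_cabs z : `|complex.Re z| <= cabs z.
Proof. by case: z => a b /=; rewrite -sqrtr_sqr ler_wsqrtr// lerDl sqr_ge0. Qed.

Lemma Im_le_cabs z : `|complex.Im z| <= cabs z.
Proof. by case: z => a b /=; rewrite -sqrtr_sqr ler_wsqrtr// lerDr sqr_ge0. Qed.

Lemma cabs_le_ReIm z : cabs z <= `|complex.Re z| + `|complex.Im z|.
Proof.
case: z => a b /=; rewrite -[leRHS]ger0_norm ?addr_ge0// -sqrtr_sqr ler_wsqrtr//.
rewrite sqrrD !real_normK ?num_real// -addrA lerD2l lerDr mulrn_wge0//.
Qed.

Lemma cabs_sum (I : Type) (r : seq I) (P : pred I) (F : I -> R[i]) :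
  cabs (\sum_(i <- r | P i) F i) <= \sum_(i <- r | P i) cabs (F i).
Proof.
elim/big_rec2: _ => [|i x y _ h]; first by rewrite cabs0.
by apply: le_trans (cabsD _ _) _; rewrite lerD2l.
Qed.

Lemma ReD z w : complex.Re (z + w) = complex.Re z + complex.Re w.
Proof. by case: z w => ? ? []. Qed.

Lemma ImD z w : complex.Im (z + w) = complex.Im z + complex.Im w.
Proof. by case: z w => ? ? []. Qed.

Lemma ReN z : complex.Re (- z) = - complex.Re z.
Proof. by case: z. Qed.

Lemma ImN z : complex.Im (- z) = - complex.Im z.
Proof. by case: z. Qed.

End complex_modulus.

Section characters.
Variables (R : realType) (d : nat).
Implicit Types (k : 'rV[int]_d) (x : 'rV[R]_d).

Lemma cabs_character k x : cabs (character k x) = 1.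
Proof. by rewrite /= cos2Dsin2 sqrtr1. Qed.

Lemma characterD k x y :
  character k (x + y) = character k x * character k y :> R[i].
Proof.
rewrite /character; under eq_bigr do rewrite mxE mulrDr.
rewrite big_split /= cosD sinD; set a := cos _; set b := sin _.
by set a' := cos _; set b' := sin _; simpc; congr (_ +i* _)%C; rewrite addrC.
Qed.

(* If e_k(h) = - e_l(h), then averaging f(x) and e_k(-h) f(x + h) fixes e_k and
   annihilates e_l. *)
Lemma character_separated k l : k != l ->
  exists h : 'rV[R]_d, character l h = - character k h.
Proof.
move=> /eqP kl; have [i kli] : exists i, k 0 i != l 0 i.
  apply/not_existsP => h; apply: kl; apply/rowP => i.
  by apply/eqP; move: (h i) => /negP; rewrite negbK.
have n0 : ((l 0 i - k 0 i)%:~R : R) != 0.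
  by rewrite intr_eq0 subr_eq0 eq_sym.
pose h : 'rV[R]_d := \row_j (if j == i then pi / (l 0 i - k 0 i)%:~R else 0).
exists h.
have E (m : 'rV[int]_d) : \sum_(j < d) (m 0 j)%:~R * h 0 j
    = (m 0 i)%:~R * (pi / (l 0 i - k 0 i)%:~R).
  rewrite (bigD1 i)//= big1 ?addr0; last first.
    by move=> j ji; rewrite mxE (negbTE ji) mulr0.
  by rewrite mxE eqxx.
rewrite /character !E.
have -> : (l 0 i)%:~R = (k 0 i)%:~R + (l 0 i - k 0 i)%:~R :> R.
  by rewrite -intrD addrC subrK.
rewrite mulrDl (mulrC (l 0 i - _)%:~R) divfK//.
by rewrite cosDpi sinDpi.
Qed.

(** Induction on the frequencies to be removed. Averaging [f x] with
    [(character k h)^-1 * f (x + h)] keeps the [k] term, kills one frequency and multiplies each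
    remaining coefficient by a constant, hence the quantification over [c]; the bound [M] survives
    because the factor has modulus one. *)
Lemma coef_le_trigpoly k (c0 : R[i]) (M : R) (s : seq 'rV[int]_d)
    (c : 'rV[int]_d -> R[i]) : k \notin s ->
  (forall x : 'rV[R]_d,
    cabs (c0 * character k x + \sum_(l <- s) c l * character l x) <= M) ->
  cabs c0 <= M.
Proof.
elim: s c => [|l s IH] c.
  move=> _ /(_ 0); rewrite big_nil addr0 cabsM cabs_character mulr1.
  exact.
rewrite inE negb_or => /andP[kl ks] H.
have [h hE] := character_separated kl.
have kh0 : character k h != 0 :> R[i].
  by apply/eqP => e; move: (cabs_character k h); rewrite e cabs0 => /eqP;
    rewrite eq_sym oner_eq0.
apply: (IH (fun m => c m * ((1 + (character k h)^-1 * character m h) / 2)) ks) => x.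
pose f y := c0 * character k y + \sum_(m <- l :: s) c m * character m y.
have -> : c0 * character k x + \sum_(m <- s) c m *
     ((1 + (character k h)^-1 * character m h) / 2) * character m x
   = 2^-1 * (f x + (character k h)^-1 * f (x + h)).
  have n2 : (2 : R[i]) != 0 by rewrite pnatr_eq0.
  rewrite /f !big_cons !characterD hE.
  under [X in _ + (_ * (_ + (_ + X)))]eq_bigr do rewrite characterD.
  rewrite [RHS](_ : _ = c0 * character k x + 2^-1 *
    (\sum_(m <- s) c m * character m x + (character k h)^-1 *
      (\sum_(m <- s) c m * (character m x * character m h)))); last first.
    by field; rewrite kh0.
  congr (_ + _); rewrite mulr_sumr -big_split /= mulr_sumr.
  by apply: eq_bigr => m _; field.
rewrite cabsM; have -> : cabs (2^-1 : R[i]) = 2^-1.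
  by rewrite ComplexField.Normc.normcV (_ : 2 = (2%:R%:C)%C) ?cabsR ?normr_nat//
    rmorph_nat.
rewrite ler_pdivrMl//; apply: le_trans (cabsD _ _) _.
rewrite cabsM ComplexField.Normc.normcV cabs_character invr1 mul1r mulr_natl mulr2n.
by rewrite lerD// H.
Qed.

End characters.

(** * Littlewood-Paley blocks *)

Section powR_comparison.
Variable R : realType.
Implicit Types a p q x y L U : R.

Lemma le0_ler_powR p x y : p <= 0 -> 0 < x -> x <= y -> y `^ p <= x `^ p.
Proof.
move=> p0 x0 xy; have y0 := lt_le_trans x0 xy.
rewrite -[p]opprK !(powRN _ (- p)) lef_pV2 ?posrE ?powR_gt0//.
by rewrite ge0_ler_powR ?nnegrE ?oppr_ge0// ltW.
Qed.

(** Adding the powers of both endpoints covers every sign of [p] in one formula; the exponents are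
    Besov indices or time weights of unknown sign. *)
Lemma powR_sandwich L U q y p : 0 < L -> 0 < U -> 0 < q ->
  L * q <= y <= U * q -> y `^ p <= (L `^ p + U `^ p) * q `^ p.
Proof.
move=> L0 U0 q0 /andP[Ly yU]; rewrite mulrDl -!powRM ?(ltW L0) ?(ltW U0) ?(ltW q0)//.
have y0 : 0 < y by apply: lt_le_trans Ly; rewrite mulr_gt0.
have [p0|p0] := leP 0 p.
  apply: ler_wpDl; first exact: powR_ge0.
  by apply: ge0_ler_powR => //; rewrite nnegrE ltW// mulr_gt0.
apply: ler_wpDr; first exact: powR_ge0.
by apply: le0_ler_powR => //; [exact: ltW|exact: mulr_gt0].
Qed.

Lemma powR_small (p x T : R) : 0 < p -> 0 < x -> 0 < T ->
  exists2 h : R, 0 < h <= T & h `^ p <= x.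
Proof.
move=> p0 x0 T0; exists (Num.min T (x `^ p^-1)).
  by rewrite lt_min T0 powR_gt0//= ge_min lexx.
have {2}-> : x = (x `^ p^-1) `^ p.
  by rewrite -powRrM mulVf ?gt_eqF// powRr1// ltW.
apply: ge0_ler_powR; rewrite ?nnegrE ?powR_ge0 ?(ltW p0)//.
  by rewrite le_min (ltW T0) powR_ge0.
by rewrite ge_min lexx orbT.
Qed.

End powR_comparison.

Section lattice_box.
Variable d : nat.

Definition box (n : nat) : seq 'rV[int]_d :=
  [seq \row_i ((f i : nat)%:Z - n%:Z) | f : {ffun 'I_d -> 'I_(n.*2.+1)}].

Lemma box_uniq n : uniq (box n).
Proof.
rewrite map_inj_uniq ?enum_uniq// => f g /rowP fg; apply/ffunP => i.
by have := fg i; rewrite !mxE => /addIr [] /val_inj.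
Qed.

Lemma size_box n : size (box n) = (n.*2.+1 ^ d)%N.
Proof. by rewrite size_map -cardE card_ffun !card_ord. Qed.

Lemma mem_box n (k : 'rV[int]_d) : (forall i, `|k 0 i| <= n%:Z) -> k \in box n.
Proof.
move=> h; have P i : (`|(k 0 i + n%:Z)%R| < n.*2.+1)%N.
  have := h i; rewrite ler_norml => /andP[h1 h2].
  rewrite ltnS -lez_nat gez0_abs -?addnn ?PoszD ?lerD2r//.
  by rewrite -lerBlDr sub0r.
apply/mapP; exists [ffun i => Ordinal (P i)]; first by rewrite mem_enum.
apply/rowP => i; rewrite mxE ffunE /= gez0_abs ?addrK//.
by have := h i; rewrite ler_norml => /andP[h1 _]; rewrite -lerBlDr sub0r.
Qed.

End lattice_box.

Section littlewood_paley.
Variables (R : realType) (d : nat) (chi rho : 'rV[R]_d -> R).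
Hypothesis hLP : dyadic_partition chi rho.

Local Notation symb := (lp_symbol chi rho).
Local Notation block := (lp_block chi rho).
Local Notation bnorm := (besov_norm chi rho).

Lemma enorm_ge0 (x : 'rV[R]_d) : 0 <= enorm x.
Proof. exact: sqrtr_ge0. Qed.

Lemma enormZ (a : R) (x : 'rV[R]_d) : enorm (a *: x) = `|a| * enorm x.
Proof.
rewrite /enorm; under eq_bigr do rewrite mxE exprMn.
by rewrite -mulr_sumr sqrtrM ?sqr_ge0// sqrtr_sqr.
Qed.

Lemma coord_le_enorm (x : 'rV[R]_d) i : `|x 0 i| <= enorm x.
Proof.
rewrite -sqrtr_sqr ler_wsqrtr// (bigD1 i)//= lerDl sumr_ge0// => j _.
exact: sqr_ge0.
Qed.

Definition bracket (k : 'rV[int]_d) : R := 1 + enorm (freq R k).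

Lemma bracket_ge1 k : 1 <= bracket k.
Proof. by rewrite lerDl enorm_ge0. Qed.

Lemma bracket_gt0 k : 0 < bracket k.
Proof. exact: lt_le_trans (bracket_ge1 k). Qed.

Lemma lp_symbol_ge0 j x : 0 <= symb j x.
Proof. by case: j => [|j] /=; [exact: (dp_ge0 hLP x).1|exact: (dp_ge0 hLP _).2]. Qed.

Lemma series_rho_le n x : series (fun j => rho ((2 ^- j : R) *: x)) n <= 1 - chi x.
Proof.
have h := @dp_sum _ _ _ _ hLP x.
rewrite -(cvg_lim _ h)//; apply: nondecreasing_cvgn_le; last by apply/cvg_ex; eexists; exact: h.
by apply: nondecreasing_series => i _ _; exact: (dp_ge0 hLP _).2.
Qed.

Lemma lp_symbol_le1 j x : symb j x <= 1.
Proof.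
case: j => [|j] /=.
  by have := series_rho_le 0 x; rewrite /series/= big_geq// subr_ge0.
apply: (@le_trans _ _ (series (fun j => rho ((2 ^- j : R) *: x)) j.+1)).
  rewrite /series/= big_nat_recr//= lerDr sumr_ge0// => i _.
  exact: (dp_ge0 hLP _).2.
by apply: le_trans (series_rho_le _ _) _; rewrite lerBlDr lerDl (dp_ge0 hLP x).1.
Qed.

(** Annuli at distance at least 2 are disjoint, so at most two terms of the [rho] series are nonzero
    at [x]. If all symbols were below 1/4, the partition of unity would sum to less than 3/4. *)
Lemma lp_symbol_large x : exists j, 4^-1 <= symb j x.
Proof.
apply/not_existsP => H; have {}H j : symb j x < 4^-1.
  by rewrite ltNge; apply/negP/H.
pose r j := rho ((2 ^- j : R) *: x).
have rlt j : r j < 4^-1 by exact: (H j.+1).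
have r0 j : 0 <= r j by exact: (dp_ge0 hLP _).2.
have S n : series r n <= 2^-1.
  elim: n => [|n IH]; first by rewrite /series/= big_geq.
  have [rn0|rn0] := eqVneq (r n) 0; first by rewrite seriesSr rn0 addr0.
  case: n IH rn0 => [_ _|n IH rn0].
    by rewrite /series/= big_nat1; have := rlt 0%N; lra.
  rewrite !seriesSr (_ : series r n = 0) ?add0r.
    by have := rlt n; have := rlt n.+1; lra.
  rewrite /series/= big_nat_cond big1// => i /andP[/andP[_ ni] _].
  have := @dp_disjoint_annuli _ _ _ _ hLP i n.+1 x; rewrite addn2 ltnS => /(_ ni)/eqP.
  by rewrite mulf_eq0 (negbTE rn0) orbF => /eqP.
have := H 0%N => /= chi4.
have : 1 - chi x <= 2^-1.
  have h := @dp_sum _ _ _ _ hLP x; rewrite -(cvg_lim _ h)//.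
  by apply: limr_le; [apply/cvg_ex; eexists; exact: h|exact: nearW].
lra.
Qed.

Lemma pow2B1 j : (2 : R) `^ (j.+1%:R - 1) = 2 ^+ j.
Proof. by rewrite -[j.+1%:R]natr1 addrK powR_mulrn. Qed.

(** This two-sided comparison lets the dyadic weights of the Besov norm be traded for powers of 1 +
    |k|. *)
Lemma lp_scale : exists L U : R, [/\ 0 < L, 0 < U &
  forall j x, symb j x != 0 ->
    L * (1 + enorm x) <= 2 `^ (j%:R - 1) <= U * (1 + enorm x)].
Proof.
have [r hr] := dp_ball hLP; have [a [b [a0 hab]]] := dp_annulus hLP.
have r1 : 0 < 1 + `|r| by rewrite ltr_wpDr.
have b1 : 0 < 1 + `|b| by rewrite ltr_wpDr.
(* The first entry of each pair serves the ball (index 0, where the dyadic scale is 1/2), the second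
   one the annuli. *)
exists (Num.min (2^-1 * (1 + `|r|)^-1) (1 + `|b|)^-1), (Num.max 1 a^-1); split.
- by rewrite lt_min !(mulr_gt0, invr_gt0).
- by rewrite lt_max ltr01.
move=> j x; have q0 : 0 < 1 + enorm x by rewrite ltr_wpDr ?enorm_ge0.
case: j => [|j] /= h; apply/andP; split.
- rewrite sub0r powR_inv1//; apply: le_trans (_ : 2^-1 * (1 + `|r|)^-1 * (1 + enorm x) <= _).
    by rewrite ler_pM2r// ge_min lexx.
  rewrite -mulrA ler_piMr// ler_pdivrMl// mulr1 lerD2l.
  exact: le_trans (hr _ h) (ler_norm _).
- rewrite sub0r powR_inv1//; apply: (@le_trans _ _ 1); first lra.
  rewrite -[leLHS]mul1r ler_pM//; first by rewrite le_max lexx.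
  by rewrite lerDl enorm_ge0.
- have /andP[_] := hab _ h; rewrite enormZ ger0_norm ?invr_ge0// pow2B1 => hb.
  apply: le_trans (_ : (1 + `|b|)^-1 * (1 + enorm x) <= _).
    by rewrite ler_pM2r// ge_min lexx orbT.
  rewrite ler_pdivrMl// mulrDl mul1r lerD// ?exprn_ege1 ?ler1n//.
  rewrite mulrC; move: hb; rewrite ler_pdivrMl// => /le_trans; apply.
  by rewrite ler_pM2l// ler_norm.
- have /andP[ha _] := hab _ h; move: ha; rewrite enormZ ger0_norm ?invr_ge0// pow2B1 => ha.
  apply: le_trans (_ : a^-1 * (1 + enorm x) <= _); last first.
    by rewrite ler_pM2r// le_max lexx orbT.
  rewrite ler_pdivlMl// mulrC; move: ha; rewrite ler_pdivlMl// => /le_trans; apply.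
  by rewrite lerDr.
Qed.

(** The size of the box matters: it bounds the number of terms of a block by a multiple of its scale
    to the power d. In [C], the summand 2 absorbs the rounding up, the scale being at least 1/2. *)
Lemma lp_support : exists (N : nat -> nat) (C : R), 0 < C /\
  forall j, (N j)%:R <= C * 2 `^ (j%:R - 1) /\
    forall k, symb j (freq R k) != 0 -> k \in box d (N j).
Proof.
have [L [U [L0 U0 h]]] := lp_scale.
exists (fun j => (Num.truncn (2 `^ (j%:R - 1) / L)).+1), (L^-1 + 2); split.
  by rewrite addr_gt0 ?invr_gt0.
move=> j; have y0 : 0 < (2 : R) `^ (j%:R - 1) by rewrite powR_gt0.
have y2 : 1 <= 2 * (2 : R) `^ (j%:R - 1).
  case: j {y0} => [|j]; first by rewrite sub0r powR_inv1// divff.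
  by rewrite pow2B1 -exprS exprn_ege1 ?ler1n.
split.
  rewrite -[(Num.truncn _).+1%:R]natr1 mulrDl lerD// [leRHS]mulrC.
  by rewrite truncn_le divr_ge0// ltW.
move=> k /h /andP[hk _]; apply: mem_box => i.
rewrite -(ler_int R) intr_norm; apply: ltW; apply: le_lt_trans (truncnS_gt _).
apply: (@le_trans _ _ (1 + enorm (freq R k))); last by rewrite ler_pdivlMr// mulrC.
apply: le_trans (_ : enorm (freq R k) <= _); last by rewrite lerDr.
by have := coord_le_enorm (freq R k) i; rewrite mxE.
Qed.

Lemma lp_block_boxE (N : nat) j :
    (forall k, symb j (freq R k) != 0 -> k \in box d N) ->
  forall u x, block j u x =
    \sum_(k <- box d N) (symb j (freq R k))%:C%C * u k * character k x.
Proof.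
move=> h u x; rewrite /lp_block -(fsbig_widen [set` box d N])//.
  exact/esym/fsbig_seq/box_uniq.
move=> k [_ /= /negP kN]; have [->|/h] := eqVneq (symb j (freq R k)) 0.
  by rewrite !mul0r.
by rewrite (negbTE kN).
Qed.

Lemma lp_blockE j : exists2 s : seq 'rV[int]_d, uniq s &
  forall u x, block j u x =
    \sum_(k <- s) (symb j (freq R k))%:C%C * u k * character k x.
Proof.
have [N [C [_ /(_ j)[_ /lp_block_boxE h]]]] := lp_support.
by exists (box d (N j)) => //; exact: box_uniq.
Qed.

Lemma lp_block_linear j (z : R[i]) u v x :
  block j (z \*o u + v) x = z * block j u x + block j v x.
Proof.
have [s _ E] := lp_blockE j; rewrite !E mulr_sumr -big_split.
apply: eq_bigr => k _ /=; have -> : (z \*o u + v) k = z * u k + v k by [].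
by ring.
Qed.

(** The list depends on [j] alone, so convergence of each coefficient forces uniform convergence of
    each block. *)
Lemma lp_block_le j : exists s : seq 'rV[int]_d,
  forall u x, cabs (block j u x) <= \sum_(k <- s) cabs (u k).
Proof.
have [s _ E] := lp_blockE j; exists s => u x; rewrite E.
apply: le_trans (cabs_sum _ _ _) _; apply: ler_sum => k _.
rewrite !cabsM cabs_character mulr1 cabsR ger0_norm ?lp_symbol_ge0//.
by rewrite ler_piMl ?cabs_ge0// lp_symbol_le1.
Qed.

Lemma coef_le_lp_block j u (M : R) k : (forall x, cabs (block j u x) <= M) ->
  symb j (freq R k) * cabs (u k) <= M.
Proof.
move=> H; have M0 : 0 <= M by apply: le_trans (H 0); exact: cabs_ge0.
have [s us E] := lp_blockE j.
have [->|s0] := eqVneq (symb j (freq R k)) 0; first by rewrite mul0r.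
have <- : cabs ((symb j (freq R k))%:C%C * u k) = symb j (freq R k) * cabs (u k).
  by rewrite cabsM cabsR ger0_norm ?lp_symbol_ge0.
have [N [C [_ /(_ j)[_ hN]]]] := lp_support.
have ks : k \in box d (N j) by exact: hN.
apply: (@coef_le_trigpoly _ _ k _ M (rem k (box d (N j)))
  (fun k => (symb j (freq R k))%:C%C * u k)).
  by rewrite mem_rem_uniq ?box_uniq// inE eqxx.
move=> x; have := H x; rewrite (lp_block_boxE hN) (perm_big _ (perm_to_rem ks)).
by rewrite big_cons.
Qed.

End littlewood_paley.

Lemma ler_normM (R : realType) (C x y : R) : 0 <= x -> x <= y -> C * x <= `|C| * y.
Proof.
move=> x0 xy; apply: (@le_trans _ _ (`|C| * x)); first by rewrite ler_wpM2r// ler_norm.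
by rewrite ler_wpM2l.
Qed.

(** * Besov and Hoelder spaces *)

Section besov_spaces.
Variables (R : realType) (d : nat) (chi rho : 'rV[R]_d -> R).
Hypothesis hLP : dyadic_partition chi rho.

Local Notation block := (lp_block chi rho).
Local Notation bnorm := (besov_norm chi rho).

Lemma scale1_fourier (u : fourier R d) : 1 \*o u = u.
Proof. by apply/funext => k; rewrite /= mul1r. Qed.

Lemma scaleN1_fourier (u : fourier R d) : (-1) \*o u = - u.
Proof. by apply/funext => k; rewrite /= mulN1r. Qed.

Lemma linf_norm_leP (f : 'rV[R]_d -> R[i]) (M : R) :
  (linf_norm f <= M%:E)%E <-> forall x, cabs (f x) <= M.
Proof.
split=> [h x|h].
  by rewrite -lee_fin; apply: le_trans h; apply: ereal_sup_ubound; exists x.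
by apply: ge_ereal_sup => _ [x _ <-]; rewrite lee_fin.
Qed.

Lemma besov_normP a u (M : R) : (bnorm a u <= M%:E)%E <->
  forall j x, 2 `^ ((j%:R - 1) * a) * cabs (block j u x) <= M.
Proof.
have w0 j : 0 < (2 : R) `^ ((j%:R - 1) * a) by rewrite powR_gt0.
have E j : ((2 `^ ((j%:R - 1) * a))%:E * linf_norm (block j u) <= M%:E)%E <->
    forall x, 2 `^ ((j%:R - 1) * a) * cabs (block j u x) <= M.
  rewrite -lee_pdivlMl// -EFinM linf_norm_leP.
  by split=> h x; have := h x; rewrite ler_pdivlMl.
split=> [h j|h].
  by apply/E; apply: le_trans h; apply: ereal_sup_ubound; exists j.
by apply: ge_ereal_sup => _ [j _ <-]; exact/E.
Qed.

Lemma besov_norm_ge0 a u : (0 <= bnorm a u)%E.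
Proof.
apply: (@le_trans _ _ ((2 `^ ((0%:R - 1) * a))%:E * linf_norm (block 0 u))%E).
  rewrite mule_ge0 ?lee_fin ?powR_ge0//.
  apply: (@le_trans _ _ (cabs (block 0 u 0))%:E); first by rewrite lee_fin cabs_ge0.
  by apply: ereal_sup_ubound; exists 0.
by apply: ereal_sup_ubound; exists 0%N.
Qed.

Lemma besov_norm_fineK a u : (bnorm a u < +oo)%E -> (fine (bnorm a u))%:E = bnorm a u.
Proof. by move=> h; rewrite fineK// ge0_fin_numE// besov_norm_ge0. Qed.

Lemma besov_norm_linear a (z : R[i]) u v (M N : R) :
  (bnorm a u <= M%:E)%E -> (bnorm a v <= N%:E)%E ->
  (bnorm a (z \*o u + v) <= (cabs z * M + N)%:E)%E.
Proof.
move=> /besov_normP hu /besov_normP hv; apply/besov_normP => j x.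
rewrite (lp_block_linear hLP).
apply: (@le_trans _ _ (2 `^ ((j%:R - 1) * a) *
    (cabs z * cabs (block j u x) + cabs (block j v x)))).
  by rewrite ler_wpM2l ?powR_ge0// -cabsM cabsD.
by rewrite mulrDr mulrCA lerD// ler_wpM2l ?cabs_ge0.
Qed.

Lemma besov_normD a u v (M N : R) :
  (bnorm a u <= M%:E)%E -> (bnorm a v <= N%:E)%E ->
  (bnorm a (u + v) <= (M + N)%:E)%E.
Proof.
move=> hu hv; have := besov_norm_linear 1 hu hv; by rewrite cabs1 mul1r scale1_fourier.
Qed.

Lemma besov_normB a u v (M N : R) :
  (bnorm a u <= M%:E)%E -> (bnorm a v <= N%:E)%E ->
  (bnorm a (u - v) <= (M + N)%:E)%E.
Proof.
move=> hu hv; have := besov_norm_linear (-1) hv hu;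
by rewrite cabsN cabs1 mul1r scaleN1_fourier addrC [N + M]addrC.
Qed.

Lemma besov_norm0 a : bnorm a 0 = 0%E.
Proof.
apply/eqP; rewrite eq_le besov_norm_ge0 andbT; apply/besov_normP => j x.
have [s _ ->] := lp_blockE hLP j; rewrite big1 ?cabs0 ?mulr0// => k _.
by rewrite mulr0 mul0r.
Qed.

(** A Fatou property: every block involves finitely many coefficients, hence passes to the limit,
    and the norm is a supremum over blocks. *)
Lemma besov_norm_lsc a (u : fourier R d) (v : nat -> fourier R d) (M : R) :
  (forall k, (fun m => cabs (v m k - u k)) @ \oo --> (0 : R)) ->
  (forall m, (bnorm a (v m) <= M%:E)%E) -> (bnorm a u <= M%:E)%E.
Proof.
move=> vu vM; apply/besov_normP => j x; set w := 2 `^ _.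
have [s hs] := lp_block_le hLP j.
pose g m := M + w * \sum_(k <- s) cabs (v m k - u k).
have gM : g @ \oo --> M.
  rewrite -[X in _ --> X]addr0 -[X in _ + X](mulr0 w); apply: cvgD; first exact: cvg_cst.
  apply: cvgM; first exact: cvg_cst.
  have : forall s' : seq 'rV[int]_d,
      (fun m => \sum_(k <- s') cabs (v m k - u k)) @ \oo --> (0 : R).
    elim=> [|k s' IH].
      rewrite [X in X @ _](_ : _ = cst 0); first exact: cvg_cst.
      by apply/funext => m; rewrite big_nil.
    rewrite [X in X @ _](_ : _ = (fun m => cabs (v m k - u k)) \+
        (fun m => \sum_(k <- s') cabs (v m k - u k))).
      by have := cvgD (vu k) IH; rewrite addr0; exact.
    by apply/funext => m; rewrite big_cons.
  exact.
rewrite -(cvg_lim _ gM)//; apply: limr_ge; first by apply/cvg_ex; exists M.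
apply: nearW => m; rewrite /g.
have /besov_normP/(_ j x) h := vM m.
apply: le_trans (_ : w * (cabs (block j (v m) x) + cabs (block j (u - v m) x)) <= _).
  rewrite ler_wpM2l ?powR_ge0//; apply: le_trans (cabsD _ _).
  have := lp_block_linear hLP j 1 (v m) (u - v m) x; rewrite mul1r => <-.
  by rewrite scale1_fourier addrC subrK.
rewrite mulrDr lerD// ler_wpM2l ?powR_ge0//; apply: le_trans (hs _ _) _.
by apply: ler_sum => k _; rewrite cabsB.
Qed.

(** Some block has symbol at least 1/4 at [k], whence the factor 4; at that block the dyadic scale
    is comparable to [bracket R k]. *)
Lemma coef_le_besov_norm a : exists2 C : R, 0 < C & forall u k (M : R),
  (bnorm a u <= M%:E)%E -> cabs (u k) <= C * M * bracket R k `^ (- a).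
Proof.
have [L [U [L0 U0 h]]] := lp_scale hLP.
exists (4 * (L `^ (- a) + U `^ (- a))); first by rewrite mulr_gt0// addr_gt0 ?powR_gt0.
move=> u k M uM; have M0 : 0 <= M by rewrite -lee_fin; apply: le_trans uM; exact: besov_norm_ge0.
have [j hj] := lp_symbol_large hLP (freq R k).
have sj0 : lp_symbol chi rho j (freq R k) != 0.
  by apply/eqP => e; move: hj; rewrite e; lra.
set y := (2 : R) `^ (j%:R - 1).
have y0 : 0 < y by rewrite powR_gt0.
have B x : cabs (block j u x) <= M * y `^ (- a).
  move/besov_normP: uM => /(_ j x); rewrite powRrM -/y => H.
  by rewrite powRN ler_pdivlMr ?powR_gt0// mulrC.
have := coef_le_lp_block hLP k B => H.
have {}H : cabs (u k) <= 4 * (M * y `^ (- a)).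
  rewrite -ler_pdivrMl//; apply: le_trans H.
  by rewrite ler_wpM2r ?cabs_ge0.
apply: le_trans H _; rewrite -!mulrA ler_pM2l// mulrCA ler_wpM2l//.
by apply: powR_sandwich => //; [exact: bracket_gt0|exact: h].
Qed.

Lemma besov_norm_eq0 a u : (bnorm a u <= 0%:E)%E -> u = 0.
Proof.
move=> h; have [C _ /(_ u) H] := coef_le_besov_norm a.
apply/funext => k; have := H k 0 h; rewrite mulr0 mul0r => u0.
by apply: ComplexField.Normc.eq0_normc; apply/eqP; rewrite eq_le u0 cabs_ge0.
Qed.

(** A converse with a loss of d derivatives: a block is bounded by the number of its frequencies, of
    order 2^(jd), times the largest coefficient, of order 2^(jp). The loss is harmless, since the
    bound serves distributions of unspecified order and smooth functions. *)
Lemma besov_norm_ltoo (C p : R) u : (forall k, cabs (u k) <= C * bracket R k `^ p) ->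
  (bnorm (- (p + d%:R)) u < +oo)%E.
Proof.
move=> H; have C0 : 0 <= C.
  have := le_trans (cabs_ge0 _) (H 0).
  by rewrite pmulr_lge0// powR_gt0// bracket_gt0.
have [L [U [L0 U0 h]]] := lp_scale hLP; have [N [D [D0 hN]]] := lp_support hLP.
pose K := (U^-1 `^ p + L^-1 `^ p).
have K0 : 0 <= K by rewrite addr_ge0 ?powR_ge0.
apply: (@le_lt_trans _ _ ((2 * D + 2) ^+ d * (C * K))%:E); last exact: ltry.
apply/besov_normP => j x; rewrite powRrM; set y := 2 `^ _.
have y0 : 0 < y by rewrite powR_gt0.
have y2 : 1 <= 2 * y.
  rewrite /y; case: j {y y0} => [|j]; first by rewrite sub0r powR_inv1// divff.
  by rewrite pow2B1 -exprS exprn_ege1 ?ler1n.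
have yn0 : y != 0 by rewrite gt_eqF.
have [NjD Nj] := hN j.
rewrite powRN -[leRHS]mulr1 ler_pdivrMl ?powR_gt0// mulr1 powRD ?yn0 ?implybT//.
rewrite (lp_block_boxE Nj); apply: le_trans (cabs_sum _ _ _) _.
apply: (@le_trans _ _ (\sum_(k <- box d (N j)) (C * (K * y `^ p)))).
  apply: ler_sum => k _; rewrite !cabsM cabs_character mulr1 cabsR ger0_norm ?lp_symbol_ge0//.
  have [->|s0] := eqVneq (lp_symbol chi rho j (freq R k)) 0.
    by rewrite mul0r !mulr_ge0 ?powR_ge0.
  apply: le_trans (_ : cabs (u k) <= _).
    by rewrite ler_piMl ?cabs_ge0// lp_symbol_le1.
  apply: le_trans (H k) _; rewrite ler_wpM2l//.
  apply: powR_sandwich; rewrite ?invr_gt0//.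
  have /andP[h1 h2] := h _ _ s0; rewrite -/y in h1 h2; apply/andP; split.
    by rewrite ler_pdivrMl.
  by rewrite ler_pdivlMl.
rewrite big_const_seq count_predT size_box iter_addr_0 -[leLHS]mulr_natl natrX.
have -> : y `^ p * y `^ d%:R * ((2 * D + 2) ^+ d * (C * K)) =
    ((2 * D + 2) * y) ^+ d * (C * (K * y `^ p)).
  by rewrite powR_mulrn ?(ltW y0)// exprMn; ring.
rewrite ler_wpM2r ?mulr_ge0 ?powR_ge0// lerXn2r ?nnegrE// ?mulr_ge0 ?addr_ge0 ?mulr_ge0 ?(ltW D0) ?(ltW y0)//.
have -> : (N j).*2.+1%:R = 2 * (N j)%:R + 1 :> R.
  by rewrite -[_.+1%:R]natr1 -mul2n natrM.
move: NjD; rewrite -/y => NjD; lra.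
Qed.

Lemma periodic_distribution_besov u : periodic_distribution u ->
  exists a, besov chi rho a u.
Proof.
move=> ud; have [C [N H]] := ud; exists (- (N%:R + d%:R)); split => //.
apply: (@besov_norm_ltoo C) => k; rewrite powR_mulrn ?H// ltW//.
exact: bracket_gt0.
Qed.

Lemma periodic_distribution_linear (z : R[i]) (u v : fourier R d) :
  periodic_distribution u -> periodic_distribution v ->
  periodic_distribution (z \*o u + v).
Proof.
move=> [C [N HC]] [D [M HD]]; exists (cabs z * `|C| + `|D|), (N + M)%N => k.
have q1 : 1 <= 1 + enorm (freq R k) := bracket_ge1 R k.
apply: le_trans (cabsD _ _) _; rewrite cabsM mulrDl -mulrA lerD//.
  rewrite ler_wpM2l ?cabs_ge0//; apply: le_trans (HC k) _; rewrite exprD.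
  apply: ler_normM; first by rewrite exprn_ge0// ltW// (bracket_gt0 R k).
  by rewrite ler_pMr ?exprn_gt0 ?exprn_ege1// (bracket_gt0 R k).
apply: le_trans (HD k) _; rewrite exprD.
apply: ler_normM; first by rewrite exprn_ge0// ltW// (bracket_gt0 R k).
by rewrite ler_pMl ?exprn_gt0 ?exprn_ege1// (bracket_gt0 R k).
Qed.

Lemma smooth_periodic_linear (z : R[i]) (u v : fourier R d) :
  smooth_periodic u -> smooth_periodic v -> smooth_periodic (z \*o u + v).
Proof.
move=> hu hv N; have [C HC] := hu N; have [D HD] := hv N.
exists (cabs z * C + D) => k; apply: le_trans (cabsD _ _) _.
by rewrite cabsM mulrDl -mulrA lerD// ler_wpM2l ?cabs_ge0.
Qed.

Lemma smooth_periodic_distribution (u : fourier R d) :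
  smooth_periodic u -> periodic_distribution u.
Proof.
by move=> /(_ 0%N)[C H]; exists C, 0%N => k; have := H k; rewrite !expr0 invr1.
Qed.

Lemma smooth_periodic_holder a u : smooth_periodic u -> holder chi rho a u.
Proof.
move=> us; split; last first.
  by move=> e e0; exists u => //; rewrite subrr besov_norm0 lee_fin ltW.
split; first exact: smooth_periodic_distribution.
(* A decay faster than |a| + d pays for the loss of d in [besov_norm_ltoo] and leaves the index
   [a]. *)
pose N := (Num.truncn (`|a| + d%:R)).+1.
have [C H] := us N.
have -> : a = - (- (a + d%:R) + d%:R) by rewrite opprD opprK addrK.
apply: (@besov_norm_ltoo `|C|) => k.
apply: le_trans (H k) _; apply: ler_normM.
  by rewrite invr_ge0 exprn_ge0// ltW// (bracket_gt0 R k).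
rewrite -powR_invn ?ler_powR ?(bracket_ge1 R k) ?(ltW (bracket_gt0 R k))//.
rewrite lerN2; apply: le_trans (ltW (truncnS_gt _)).
by rewrite lerD2r ler_norm.
Qed.

Lemma holder_periodic_distribution a u : holder chi rho a u -> periodic_distribution u.
Proof. by case=> -[]. Qed.

Lemma holder_besov_norm_ltoo a u : holder chi rho a u -> (bnorm a u < +oo)%E.
Proof. by case=> -[]. Qed.

Lemma holder_linear a (z : R[i]) u v :
  holder chi rho a u -> holder chi rho a v -> holder chi rho a (z \*o u + v).
Proof.
move=> hu hv; split.
  split; first by apply: periodic_distribution_linear; [exact: holder_periodic_distribution hu|
    exact: holder_periodic_distribution hv].
  apply: le_lt_trans (_ : (cabs z * fine (bnorm a u) + fine (bnorm a v))%:E < _)%E.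
    by apply: besov_norm_linear; rewrite besov_norm_fineK// holder_besov_norm_ltoo.
  exact: ltry.
move=> e e0; have z1 : 0 < 2 * (1 + cabs z) by rewrite mulr_gt0// ltr_wpDr ?cabs_ge0.
have [f fs hf] := hu.2 _ (divr_gt0 e0 z1).
have [|g gs hg] := hv.2 (e / 2); first by rewrite divr_gt0.
exists (z \*o f + g); first exact: smooth_periodic_linear.
have -> : (z \*o u + v) - (z \*o f + g) = z \*o (u - f) + (v - g).
  by apply/funext => k; rewrite /= !fctE /=; ring.
apply: le_trans (besov_norm_linear z hf hg) _; rewrite lee_fin.
have : cabs z * (e / (2 * (1 + cabs z))) <= e / 2; last lra.
rewrite mulrA ler_pdivrMr// [leRHS](_ : _ = (1 + cabs z) * e); last by field.
by rewrite ler_wpM2r ?(ltW e0)// lerDr.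
Qed.

Lemma holderD a u v :
  holder chi rho a u -> holder chi rho a v -> holder chi rho a (u + v).
Proof.
move=> hu hv; have := holder_linear 1 hu hv.
by rewrite scale1_fourier.
Qed.

Lemma holderB a u v :
  holder chi rho a u -> holder chi rho a v -> holder chi rho a (u - v).
Proof.
move=> hu hv; have := holder_linear (-1) hv hu.
by rewrite scaleN1_fourier addrC.
Qed.

Lemma holder0 a : holder chi rho a 0.
Proof. by apply: smooth_periodic_holder => N; exists 0 => k; rewrite cabs0 mul0r. Qed.

(** Lets a limit of Hoelder paths be Hoelder at each time. That the limit is a distribution comes
    from the coefficient bound applied to [u - v]. *)
Lemma holder_closed a u :
  (forall e : R, 0 < e -> exists2 v, holder chi rho a v & (bnorm a (u - v) <= e%:E)%E) ->
  holder chi rho a u.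
Proof.
move=> H; split; last first.
  move=> e e0; have e2 : 0 < e / 2 by rewrite divr_gt0.
  have [v hv uv] := H _ e2; have [f fs vf] := hv.2 _ e2; exists f => //.
  have -> : u - f = (u - v) + (v - f) by rewrite addrA subrK.
  by rewrite [e]splitr; exact: besov_normD.
have [v hv uv] := H 1 ltr01; have -> : u = (u - v) + v by rewrite subrK.
split.
  have : periodic_distribution (u - v).
    have [C C0 HC] := coef_le_besov_norm a.
    exists C, (Num.truncn `|a|).+1 => k.
    apply: le_trans (HC _ k _ uv) _; rewrite mulr1 ler_pM2l//.
    rewrite -powR_mulrn ?ler_powR ?(bracket_ge1 R k) ?(ltW (bracket_gt0 R k))//.
    by apply: le_trans (ltW (truncnS_gt _)); rewrite -normrN ler_norm.
  move=> /(periodic_distribution_linear 1)/(_ (holder_periodic_distribution hv)).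
  by rewrite scale1_fourier.
apply: le_lt_trans (_ : (1 + fine (bnorm a v))%:E < _)%E; last exact: ltry.
by apply: besov_normD => //; rewrite besov_norm_fineK// holder_besov_norm_ltoo.
Qed.

(** * Smoothing and right continuity of the semigroup *)

Section semigroup_continuity.
Variables (a0 : R) (DA : set (fourier R d)) (A : fourier R d -> fourier R d).
Variables (S : R -> fourier R d -> fourier R d) (tau : R).
Hypothesis hA : generates_analytic_semigroup chi rho a0 DA A S.
Hypothesis hS : distribution_semigroup S.
Hypothesis hsmooth : smoothing chi rho tau S.

(** A distribution lies in some Besov space of index [a]; [smoothing] then gains any number [b] of
    derivatives, and [a + b] bounds the decay of the coefficients. *)
Lemma semigroup_smooth_periodic (t : R) u : 0 < t -> periodic_distribution u ->
  smooth_periodic (S t u).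
Proof.
move=> t0 ud; have [a ua] := periodic_distribution_besov ud.
have P b : 0 <= b -> (bnorm (a + b) (S t u) < +oo)%E.
  move=> b0; have [c hc] := hsmooth a b0; apply: le_lt_trans (hc _ _ t0 ua) _.
  case: (ua) => _ ual; rewrite -(besov_norm_fineK ual) -EFinM; exact: ltry.
move=> N; pose b := `|N%:R - a|.
have [C _ H] := coef_le_besov_norm (a + b).
exists (`|C * fine (bnorm (a + b) (S t u))|) => k.
have {}H : cabs (S t u k) <= C * fine (bnorm (a + b) (S t u)) * bracket R k `^ (- (a + b)).
  by apply: H; rewrite besov_norm_fineK ?P /b// normr_ge0.
apply: le_trans H _; apply: ler_normM; first exact: powR_ge0.
rewrite -powR_invn ?ler_powR ?(bracket_ge1 R k) ?(ltW (bracket_gt0 R k))//.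
by rewrite lerN2 addrC -lerBlDr ler_norm.
Qed.

(* For t > 0, S t u is smooth, hence lies in the space C^a0 where the semigroup
   is strongly continuous. *)
Lemma semigroup_right_continuous (t : R) u k (e : R) : 0 < t ->
  periodic_distribution u -> 0 < e ->
  exists2 r : R, 0 < r & forall h, 0 < h < r ->
    cabs (S (t + h) u k - S t u k) <= e.
Proof.
move=> t0 ud e0; case: hA => -[m [Sz [m0 [_ _ _ hcont _] SE]]] _ _ _ _.
have hw : holder chi rho a0 (S t u).
  by apply: smooth_periodic_holder; exact: semigroup_smooth_periodic.
have [C C0 HC] := coef_le_besov_norm a0.
pose q := bracket R k `^ (- a0).
have q0 : 0 < q by rewrite powR_gt0// bracket_gt0.
have [|r r0 hr] := hcont _ hw (e / (C * q)); first by rewrite divr_gt0// mulr_gt0.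
exists r => // h /andP[h0 hr'].
have -> : S (t + h) u = Sz (h%:C)%C (S t u).
  by case: hS => _ _ _ hadd; rewrite addrC hadd ?(ltW h0) ?(ltW t0)// SE// ltW.
have := hr (h%:C)%C; rewrite cabsR gtr0_norm// => /(_ _ hr') H.
have sec : sector m (h%:C)%C by split => //=; rewrite normr0 mulr_gt0.
have := HC _ k _ (H sec); rewrite -/q => h1; apply: le_trans h1 _.
rewrite le_eqVlt; apply/orP; left; apply/eqP; field.
by rewrite !gt_eqF.
Qed.

End semigroup_continuity.
End besov_spaces.

(** * Singular time integrals *)

Section lower_integral.
Context {dd : measure_display} {T : measurableType dd} {R : realType}.
Variable mu : {measure set T -> \bar R}.

(** The integral of a nonnegative function is a supremum over the simple functions below it, so it
    is monotone on arbitrary functions. It is applied to products of norms of paths, whose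
    measurability in time is never established. *)
Lemma ge0_le_lower_integral (D : set T) (f g : T -> \bar R) :
  (forall x, D x -> 0 <= f x)%E -> (forall x, D x -> f x <= g x)%E ->
  (\int[mu]_(x in D) f x <= \int[mu]_(x in D) g x)%E.
Proof.
move=> f0 fg; rewrite !ge0_integralE//; last first.
  by move=> x Dx; apply: le_trans (f0 _ Dx) (fg _ Dx).
apply: le_ereal_sup => _ [h hf <-]; exists h => // x.
by apply: le_trans (hf x) _; apply: lee_restrict.
Qed.

End lower_integral.

Section singular_integrals.
Variable R : realType.
Local Notation mu := (@lebesgue_measure R).
Implicit Types (a b c t p x M : R) (f F : R -> R).

(** [f] may blow up at both ends: the fundamental theorem is used on compact subintervals, and
    monotone convergence exhausts the open interval. *)
Lemma integral_le_antiderivative f F a b M : a < b ->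
  (forall x, a < x < b -> 0 <= f x) ->
  (forall x, a < x < b -> {for x, continuous f}) ->
  (forall x, a < x < b -> is_derive x 1 F (f x)) ->
  (forall x, a < x < b -> 0 <= F x <= M) ->
  (\int[mu]_(x in `]a, b[) (f x)%:E <= M%:E)%E.
Proof.
move=> ab f0 cf dF FM.
(* Dividing by at least 3 leaves a nondegenerate interval after cutting [h n] off both ends. *)
have [h hE] : exists h : nat -> R, forall n, h n = (b - a) / n.+3%:R.
  by exists (fun n => (b - a) / n.+3%:R).
have h0 n : 0 < h n by rewrite hE divr_gt0// subr_gt0.
have hlt n : a + h n < b - h n.
  have : h n <= (b - a) / 3 by rewrite hE ler_pM2l ?subr_gt0// lef_pV2 ?posrE// ler_nat.
  by move: ab; lra.
have hn n : h n.+1 <= h n.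
  by rewrite !hE ler_pM2l ?subr_gt0// lef_pV2 ?posrE// ler_nat.
pose E n : set R := `[a + h n, b - h n]%classic.
have EU : \bigcup_n E n = `]a, b[%classic.
  apply/seteqP; split=> [x [n _]|x]; rewrite /E/= !in_itv/= => /andP[ax xb].
    by apply/andP; split; have := h0 n; lra.
  pose e := Num.min (x - a) (b - x).
  have e0 : 0 < e by rewrite lt_min !subr_gt0 ax.
  exists (Num.truncn ((b - a) / e)) => //=; rewrite /E/= in_itv/=.
  have : h (Num.truncn ((b - a) / e)) <= e.
    rewrite hE ler_pdivrMr// mulrC -ler_pdivrMr//.
    apply: le_trans (ltW (truncnS_gt _)) _; rewrite ler_nat; exact: leqW.
  by rewrite le_min => /andP[h1 h2]; apply/andP; split; lra.
have Eab n x : E n x -> a < x < b.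
  move=> En; have : (\bigcup_n E n) x by exists n.
  by rewrite EU /= in_itv.
have mf : measurable_fun (\bigcup_n E n) (EFin \o f).
  rewrite EU; apply/measurable_EFinP; apply: open_continuous_measurable_fun.
    exact: interval_open.
  by move=> x; rewrite inE /= in_itv /= => /cf.
have cvg : (\int[mu]_(x in E i) (f x)%:E @[i --> \oo] -->
    \int[mu]_(x in \bigcup_i E i) (f x)%:E)%E.
  apply: ge0_nondecreasing_set_cvg_integral => //.
  - apply/nondecreasing_seqP => n; rewrite subsetEset => x.
    rewrite /E /= !in_itv/= => /andP[h1 h2]; have := hn n => h3.
    by apply/andP; split; lra.
  - by move=> n; exact: measurable_itv.
  - move=> n; apply: measurable_funS mf; last exact: bigcup_sup.
    by rewrite EU; exact: measurable_itv.
  - by move=> i x /Eab; rewrite lee_fin => /f0.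
rewrite -EU -(cvg_lim _ cvg)//; apply: lime_le; first by apply/cvg_ex; eexists; exact: cvg.
apply: nearW => n.
have cF x : a < x < b -> {for x, continuous F}.
  move=> /dF dFx; apply: differentiable_continuous; apply/derivable1_diffP.
  exact: ex_derive.
have Ea : a < a + h n < b by have := h0 n; have := hlt n; move=> ? ?; apply/andP; split; lra.
have Eb : a < b - h n < b by have := h0 n; have := hlt n; move=> ? ?; apply/andP; split; lra.
rewrite (@continuous_FTC2 _ f F)//.
- rewrite -EFinB lee_fin lerBlDr.
  have /andP[_ ?] := FM _ Eb; have /andP[? _] := FM _ Ea.
  by apply: ler_wpDr.
- apply: continuous_in_subspaceT => x; rewrite inE => Ex; exact: cf (Eab n _ Ex).
- split.
  + move=> x; rewrite in_itv /= => /andP[h1 h2].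
    have /dF : a < x < b by have := h0 n => ?; apply/andP; split; lra.
    by move=> dFx; exact: ex_derive.
  + by apply: cvg_at_right_filter; exact: cF.
  + by apply: cvg_at_left_filter; exact: cF.
- move=> x; rewrite in_itv /= => /andP[h1 h2].
  have /dF dFx : a < x < b by have := h0 n => ?; apply/andP; split; lra.
  by rewrite derive1E derive_val.
Qed.

Lemma is_derive_scaled c F x df : is_derive x 1 F df ->
  is_derive x 1 (fun s : R => c * F s) (c * df).
Proof. by move=> h; exact: (@is_deriveZ R R R F c x 1 df h). Qed.

Lemma is_derive_powR_antiderivative p x : p < 1 -> 0 < x ->
  is_derive x 1 (fun s : R => s `^ (1 - p) / (1 - p)) (x `^ (- p)).
Proof.
move=> p1 x0; have p10 : 1 - p != 0 by rewrite subr_eq0 gt_eqF.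
have := is_derive_scaled (1 - p)^-1 (is_derive1_powR (1 - p) x0).
rewrite mulrA mulVf// mul1r addrAC subrr sub0r.
by under eq_fun do rewrite mulrC.
Qed.

(** The free constant [c] is later the value of the power at the left endpoint, which makes the
    antiderivative nonnegative. *)
Lemma is_derive_powR_reflected p t c x : p < 1 -> x < t ->
  is_derive x 1 (fun s : R => (c - (t - s) `^ (1 - p)) / (1 - p)) ((t - x) `^ (- p)).
Proof.
move=> p1 xt; have p10 : 1 - p != 0 by rewrite subr_eq0 gt_eqF.
have dsub : is_derive x 1 (fun s : R => t - s) (-1).
  have := is_deriveB (is_derive_cst t x (1 : R)) (is_derive_id x (1 : R)).
  by rewrite sub0r.
have tx : 0 < t - x by rewrite subr_gt0.
have dcomp := @is_derive1_comp R (fun y => y `^ (1 - p)) (fun s => t - s) x _ _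
  (is_derive1_powR (1 - p) tx) dsub.
have := is_derive_scaled (1 - p)^-1 (is_deriveB (is_derive_cst c x (1 : R)) dcomp).
rewrite sub0r mulrN1 opprK mulrA mulVf// mul1r addrAC subrr sub0r.
by under eq_fun do rewrite mulrC.
Qed.

Lemma continuous_powR_gt0 p x : 0 < x -> {for x, continuous (fun s : R => s `^ p)}.
Proof.
move=> x0; apply: differentiable_continuous; apply/derivable1_diffP.
by apply: ex_derive; exact: is_derive1_powR.
Qed.

Lemma continuous_powR_reflected p t x : x < t ->
  {for x, continuous (fun s : R => (t - s) `^ p)}.
Proof.
move=> xt; apply: (@continuous_comp _ _ _ (fun s => t - s) (fun s : R => s `^ p)).
  by apply: cvgB; [exact: cvg_cst|exact: cvg_id].
by apply: continuous_powR_gt0; rewrite subr_gt0.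
Qed.

Lemma integral_tail_kernel (p t tau M : R) : p < 1 -> 0 <= tau < t -> 0 <= M ->
  (\int[mu]_(s in `]0%R, t[)
     ((t - s) `^ (- p) * (if s <= tau then 0 else M))%:E
   <= (M * ((t - tau) `^ (1 - p) / (1 - p)))%:E)%E.
Proof.
move=> p1 /andP[tau0 taut] M0; have p10 : 0 < 1 - p by rewrite subr_gt0.
have -> : (\int[mu]_(s in `]0%R, t[) ((t - s) `^ (- p) * (if s <= tau then 0 else M))%:E
    = \int[mu]_(s in `]tau, t[) (M * (t - s) `^ (- p))%:E)%E.
  rewrite integral_mkcond [RHS]integral_mkcond; congr integral; apply/funext => s.
  rewrite /patch !mem_setE !in_itv/=; case: (leP s tau) => stau.
    by rewrite /= mulr0; case: ifP.
  by rewrite /= (le_lt_trans tau0 stau) /= mulrC.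
apply: (@integral_le_antiderivative _
  (fun s => M * (((t - tau) `^ (1 - p) - (t - s) `^ (1 - p)) / (1 - p)))) => //.
- by move=> x _; rewrite mulr_ge0 ?powR_ge0.
- move=> x /andP[_ xt]; apply: cvgM; first exact: cvg_cst.
  exact: continuous_powR_reflected.
- by move=> x /andP[_ xt]; apply: is_deriveZ; exact: is_derive_powR_reflected.
- move=> x /andP[taux xt]; apply/andP; split.
    rewrite mulr_ge0// divr_ge0 ?(ltW p10)// subr_ge0.
    by rewrite ge0_ler_powR ?nnegrE ?(ltW p10) ?subr_ge0 ?lerD2l ?lerN2// ltW// (lt_trans taux).
  by rewrite ler_wpM2l// ler_pM2r ?invr_gt0// gerBl powR_ge0.
Qed.

(** The Beta integral is bounded rather than computed. Cutting at t/2, one of the two factors is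
    comparable to its value at scale t on each half; the sum [f] of the two majorants has the
    explicit antiderivative [F], and scaling yields the power of t. *)
Lemma integral_beta_kernel (delta theta : R) : 0 <= delta < 1 -> theta < 1 ->
  exists2 K : R, 0 < K & forall t M, 0 < t -> 0 <= M ->
  (\int[mu]_(s in `]0%R, t[)
     ((t - s) `^ (- delta) * (M * s `^ (- theta)))%:E
   <= (M * K * t `^ (1 - delta - theta))%:E)%E.
Proof.
move=> /andP[delta0 delta1] theta1.
have d10 : 0 < 1 - delta by rewrite subr_gt0.
have t10 : 0 < 1 - theta by rewrite subr_gt0.
(* [theta] may be negative, so both ends of [t/2, t] are taken into account. *)
pose D : R := 2^-1 `^ (- theta) + 1 `^ (- theta).
have D0 : 0 < D by rewrite addr_gt0 ?powR_gt0.
exists (2^-1 `^ (- delta) / (1 - theta) + D / (1 - delta)).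
  by rewrite addr_gt0// divr_gt0// powR_gt0.
move=> t M t0 M0.
pose f s := M * (t / 2) `^ (- delta) * s `^ (- theta) +
  M * D * t `^ (- theta) * (t - s) `^ (- delta).
pose F s := M * (t / 2) `^ (- delta) * (s `^ (1 - theta) / (1 - theta)) +
  M * D * t `^ (- theta) * ((t `^ (1 - delta) - (t - s) `^ (1 - delta)) / (1 - delta)).
have t2 : 0 < t / 2 by rewrite divr_gt0.
apply: (@le_trans _ _ (\int[mu]_(s in `]0%R, t[) (f s)%:E)%E).
  apply: ge0_le_lower_integral => s; rewrite /= in_itv/= => /andP[s0 st]; rewrite lee_fin.
    by rewrite !mulr_ge0 ?powR_ge0.
  have [st2|st2] := leP s (t / 2).
    apply: ler_wpDr; first by rewrite !mulr_ge0 ?powR_ge0// ltW.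
    rewrite mulrA [_ * M]mulrC ler_wpM2r ?powR_ge0// ler_wpM2l//.
    by apply: le0_ler_powR; rewrite ?oppr_le0//; lra.
  apply: ler_wpDl; first by rewrite !mulr_ge0 ?powR_ge0.
  rewrite mulrC ler_wpM2r ?powR_ge0// -mulrA ler_wpM2l//.
  by apply: powR_sandwich => //; apply/andP; split; lra.
apply: (@le_trans _ _ (M * (t / 2) `^ (- delta) * (t `^ (1 - theta) / (1 - theta)) +
  M * D * t `^ (- theta) * (t `^ (1 - delta) / (1 - delta)))%:E); last first.
  rewrite lee_fin.
  have tn0 : t != 0 by rewrite gt_eqF.
  rewrite (_ : 1 - delta - theta = (- delta) + (1 - theta)); last by ring.
  rewrite [t `^ (- delta + _)]powRD ?tn0 ?implybT// powRM ?(ltW t0)//.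
  rewrite [X in _ + X](_ : _ = M * (D / (1 - delta)) * (t `^ (- theta) * t `^ (1 - delta))); last first.
    by ring.
  rewrite -[t `^ (- theta) * _]powRD ?tn0 ?implybT//.
  rewrite (_ : - theta + (1 - delta) = (- delta) + (1 - theta)); last by ring.
  rewrite [t `^ (- delta + _)]powRD ?tn0 ?implybT//.
  by rewrite le_eqVlt; apply/orP; left; apply/eqP; ring.
apply: (@integral_le_antiderivative f F) => //.
- by move=> s _; rewrite /f addr_ge0// !mulr_ge0 ?powR_ge0// ltW.
- move=> s /andP[s0 st]; apply: cvgD; apply: cvgM; try exact: cvg_cst.
    exact: continuous_powR_gt0.
  exact: continuous_powR_reflected.
- move=> s /andP[s0 st]; apply: is_deriveD; apply: is_deriveZ.
    exact: is_derive_powR_antiderivative.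
  exact: is_derive_powR_reflected.
- move=> s /andP[s0 st]; rewrite /F.
  have h1 : s `^ (1 - theta) <= t `^ (1 - theta).
    by rewrite ge0_ler_powR ?nnegrE ?(ltW t10) ?(ltW s0) ?(ltW t0) ?(ltW st).
  have h2 : (t - s) `^ (1 - delta) <= t `^ (1 - delta).
    rewrite ge0_ler_powR ?nnegrE ?(ltW d10) ?(ltW t0) ?subr_ge0 ?(ltW st)//.
    by rewrite gerBl ltW.
  apply/andP; split.
    by rewrite addr_ge0// !mulr_ge0 ?powR_ge0 ?invr_ge0 ?subr_ge0 ?h2 ?(ltW D0) ?(ltW delta1) ?(ltW theta1).
  rewrite lerD// ler_wpM2l ?mulr_ge0 ?powR_ge0 ?(ltW D0)//.
    by rewrite ler_pM2r ?invr_gt0.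
  by rewrite ler_pM2r ?invr_gt0// gerBl powR_ge0.
Qed.

End singular_integrals.

Lemma cvgn_of_modulus (R : realType) (x e : nat -> R) :
  (forall n m, `|x (n + m)%N - x n| <= e n) -> e @ \oo --> (0 : R) -> cvgn x.
Proof.
move=> xe e0; apply/cauchy_cvgP/cauchyP => eps eps0.
move/cvgrPdist_lt : e0 => /(_ _ eps0)[n _ hn]; exists (x n).
have en : e n < eps.
  by have := hn n (leqnn n); rewrite sub0r normrN => /ltr_normlW.
exists n => // m /= nm; rewrite /ball /= distrC -(subnKC nm).
exact: le_lt_trans (xe _ _) en.
Qed.

Lemma geometric_cvg0 (R : realType) (C : R) : (fun n => C / 2 ^+ n) @ \oo --> (0 : R).
Proof.
have h : (fun n => C * (2^-1 : R) ^+ n) @ \oo --> C * 0.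
  by apply: cvgM; [exact: cvg_cst|apply: cvg_expr; rewrite ger0_norm ?invr_ge0//; lra].
rewrite mulr0 in h; apply: cvg_trans h; apply: near_eq_cvg; apply: nearW => n.
by rewrite exprVn.
Qed.

Lemma geometric_small (R : realType) (C D : R) : 0 < D -> exists n, C / 2 ^+ n <= D.
Proof.
move=> D0; have /cvgrPdist_le/(_ _ D0)[n _ hn] := geometric_cvg0 C.
exists n; have := hn n (leqnn n); rewrite sub0r normrN.
exact/le_trans/ler_norm.
Qed.

(** * Measurability of Volterra integrals *)

Section triangle_integral.
Variable R : realType.
Local Notation mu := (@lebesgue_measure R).
Variables (T : R) (g : R -> R -> R).
Hypothesis T0 : 0 < T.
Hypothesis mg : forall t : R, 0 < t <= T -> measurable_fun `]0, t[ (g t).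
Hypothesis cg : forall s t e : R, 0 < s < t -> t <= T -> 0 < e ->
  exists2 r : R, 0 < r & forall h : R, 0 < h < r -> `|g (t + h) s - g t s| <= e.

Let inside (z : R * R) : bool := [&& 0 < z.2, z.2 < z.1 & z.1 <= T].
Let G (z : R * R) : R := if inside z then g z.1 z.2 else 0.

Let grid (n m : nat) : R := Num.min T (m.+1%:R / n.+1%:R).
Let cell (n m : nat) : set R := `[m%:R / n.+1%:R, m.+1%:R / n.+1%:R[.
Let slice (n m : nat) : R -> R := (g (grid n m)) \_ `]0, grid n m[.
(* In its first variable, [approx n] freezes g at the first point of the grid of
   mesh 1/(n+1) to the right of t, where g is right continuous. *)
Let approx (n : nat) (z : R * R) : R := if inside z then
  \sum_(m < (Num.truncn (T * n.+1%:R)).+1) \1_(cell n m) z.1 * slice n m z.2 else 0.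

Let measurable_inside : measurable_fun setT inside.
Proof.
apply: measurable_and.
  by apply: measurable_fun_ltr.
apply: measurable_and.
  by apply: measurable_fun_ltr.
by apply: measurable_fun_ler.
Qed.

Let measurable_approx n : measurable_fun setT (approx n).
Proof.
apply: measurable_fun_ifT => //; apply: measurable_sum => m.
apply: measurable_funM.
  apply: (@measurableT_comp _ _ _ _ _ _ (\1_(cell n m) : R -> R)) => //.
  by apply: measurable_indic; exact: measurable_itv.
apply: (@measurableT_comp _ _ _ _ _ _ (slice n m)) => //.
apply: (measurable_restrictT (g (grid n m)) (measurable_itv `]0, grid n m[)).1.
by apply: mg; rewrite lt_min T0 divr_gt0// ge_min lexx.
Qed.

(** The half-open cells are disjoint, so exactly one term survives, that of the integer part of
    t(n+1); its slice is not truncated at s because s < t <= t + h. *)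
Let approxE n z : inside z -> exists h : R, [/\ 0 <= h, h <= n.+1%:R^-1 &
  approx n z = g (z.1 + h) z.2].
Proof.
case: z => t s zin; rewrite /approx zin /=.
have /and3P[/= s0 st tT] := zin; have t0 := lt_trans s0 st.
have n0 : 0 < n.+1%:R :> R by [].
set M := (Num.truncn (T * n.+1%:R)).+1.
pose m := Num.truncn (t * n.+1%:R).
have tn0 : 0 <= t * n.+1%:R by rewrite mulr_ge0 // ltW.
have mM : (m < M)%N by rewrite ltnS le_truncn// ler_pM2r.
have m1 : m%:R <= t * n.+1%:R by rewrite truncn_le.
have m2 : t * n.+1%:R < m.+1%:R by exact: truncnS_gt.
have tcell : t \in cell n m.
  by rewrite inE /cell /= in_itv /= ler_pdivrMr// m1 ltr_pdivlMr.
rewrite (bigD1 (Ordinal mM))//= big1 ?addr0; last first.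
  move=> i /eqP im; rewrite indicE; case: (boolP (t \in cell n i)) => [|_]; last by rewrite mul0r.
  rewrite inE /cell /= in_itv /= ler_pdivrMr// ltr_pdivlMr// => hi.
  by exfalso; apply: im; apply: val_inj; rewrite /= /m (truncn_def hi).
rewrite indicE tcell mul1r.
have tg : t <= grid n m by rewrite le_min tT ler_pdivlMr// ltW.
exists (grid n m - t); split; first by rewrite subr_ge0.
  rewrite lerBlDr; apply: (@le_trans _ _ (m.+1%:R / n.+1%:R)).
    by rewrite ge_min lexx orbT.
  rewrite ler_pdivrMr// mulrDl mulVf ?gt_eqF// -[m.+1%:R]natr1.
  lra.
rewrite addrC subrK /slice patchE ifT// inE /= in_itv /= s0.
exact: lt_le_trans st tg.
Qed.

Let approx_cvg z : (fun n => approx n z) @ \oo --> G z.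
Proof.
rewrite /G; case: ifPn => zin; last first.
  rewrite [X in X @ _](_ : _ = cst 0); first exact: cvg_cst.
  by apply/funext => n; rewrite /approx (negbTE zin).
case: z zin => t s zin; have /and3P[/= s0 st tT] := zin.
apply/cvgrPdist_le => e e0.
have [|r r0 hr] := @cg s t e _ tT e0; first by rewrite s0.
near=> n; have [h [h0 hn ->]] := approxE n zin.
(* The shift vanishes at t = T, where the grid is cut off; right continuity deals with h > 0. *)
rewrite distrC /=; move: h0; rewrite le_eqVlt => /predU1P[<-|h0].
  by rewrite addr0 subrr normr0 ltW.
apply: hr; rewrite h0 /=; apply: le_lt_trans hn _.
by near: n; exact: near_infty_natSinv_lt (PosNum r0).
Unshelve. all: by end_near. Qed.

Let measurable_G : measurable_fun setT G.
Proof. by apply: (measurable_fun_cvg measurable_approx) => z _; exact: approx_cvg. Qed.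

Lemma measurable_fun_triangle_integral :
  measurable_fun `]0, T] (fun t => \int[mu]_(s in `]0, t[) g t s).
Proof.
pose Gt t := (\int[mu]_s (G (t, s))%:E)%E.
apply: (@eq_measurable_fun _ _ _ _ _ (fine \o Gt)).
  move=> t; rewrite inE /= in_itv /= => /andP[t0 tT].
  rewrite /Rintegral /Gt; congr fine; rewrite [RHS]integral_mkcond.
  apply: eq_integral => s _; rewrite patchE /G /inside /= tT andbT mem_setE in_itv /=.
  by case: ifP.
apply: measurable_funTS; apply: measurableT_comp; first exact: fine_measurable.
have mE : measurable_fun setT (EFin \o G) by exact/measurable_EFinP.
(* Tonelli needs a sign, so the positive and negative parts are integrated separately. *)
rewrite [Gt](_ : _ = (fubini_F mu (fun z => (EFin \o G)^\+%E z)
    \- fubini_F mu (fun z => (EFin \o G)^\-%E z))%E); last first.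
  apply/funext => t; rewrite /Gt integralE /fubini_F.
  by congr (_ - _)%E; apply: eq_integral => s _; rewrite ?funeposE ?funenegE.
apply: emeasurable_funB; apply: measurable_fun_fubini_tonelli_F => //.
  exact: measurable_funepos.
exact: measurable_funeneg.
Qed.

End triangle_integral.

(** * Mild solutions *)

Section mild_solutions.
Variables (R : realType) (d : nat) (chi rho : 'rV[R]_d -> R).
Hypothesis hLP : dyadic_partition chi rho.
Variables (a0 : R) (DA : set (fourier R d)) (A : fourier R d -> fourier R d).
Variable S : R -> fourier R d -> fourier R d.
Hypothesis hA : generates_analytic_semigroup chi rho a0 DA A S.
Hypothesis hS : distribution_semigroup S.
Variable tau : R.
Hypothesis hsmooth : smoothing chi rho tau S.
Variables alpha delta c : R.
Hypotheses (hdelta : 0 <= delta < 1) (hc : 0 < c).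
Variable B : fourier R d -> fourier R d -> fourier R d.
Hypothesis hB : symmetric_bilinear_on (holder chi rho alpha) B.
Hypothesis hV : duhamel_bound chi rho alpha delta c S B.

Local Notation bnorm := (besov_norm chi rho alpha).
Local Notation hol := (holder chi rho alpha).
Local Notation hpath := (holder_path chi rho alpha).
Local Notation V := (duhamel S B).
Local Notation mu := (@lebesgue_measure R).
Implicit Types (u v w z : R -> fourier R d) (t T M N D b : R).

Definition bounded_path b M T u : Prop :=
  forall t, 0 < t <= T -> (bnorm (u t) <= (M * t `^ (- b))%:E)%E.

Lemma path_norm_leP b M T u :
  (path_norm chi rho alpha b T u <= M%:E)%E <-> bounded_path b M T u.
Proof.
have E t : 0 < t -> ((t `^ b)%:E * bnorm (u t) <= M%:E)%E <->
    (bnorm (u t) <= (M * t `^ (- b))%:E)%E.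
  by move=> t0; rewrite -lee_pdivlMl ?powR_gt0// -EFinM powRN mulrC.
split=> [h t tT|h].
  have /andP[t0 _] := tT; apply/(E _ t0); apply: le_trans h.
  by apply: ereal_sup_ubound; exists t => //; rewrite /= in_itv.
apply: ge_ereal_sup => _ [t + <-]; rewrite /= in_itv /= => tT.
by have /andP[t0 _] := tT; apply/(E _ t0); exact: h.
Qed.

Lemma path_space_bounded b T u : path_space chi rho alpha b T u ->
  hpath T u /\ exists2 M, 0 <= M & bounded_path b M T u.
Proof.
move=> [hu hn]; split=> //; exists (Num.max 0 (fine (path_norm chi rho alpha b T u))).
  by rewrite le_max lexx.
apply/path_norm_leP; case: (path_norm chi rho alpha b T u) hn => [r| |]//= _.
  by rewrite lee_fin le_max lexx orbT.
exact: leNye.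
Qed.

Lemma bounded_path_space b M T u : hpath T u -> bounded_path b M T u ->
  path_space chi rho alpha b T u.
Proof.
by move=> hu /path_norm_leP h; split=> //; apply: le_lt_trans h _; exact: ltry.
Qed.

Lemma bounded_path_le b M N T T' u : M <= N -> T' <= T ->
  bounded_path b M T u -> bounded_path b N T' u.
Proof.
move=> MN TT h t /andP[t0 tT]; apply: le_trans (h t _) _.
  by rewrite t0 (le_trans tT).
by rewrite lee_fin ler_wpM2r ?powR_ge0.
Qed.

Lemma bounded_pathB b M N T u v : bounded_path b M T u -> bounded_path b N T v ->
  bounded_path b (M + N) T (u - v).
Proof.
move=> hu hv t tT; rewrite mulrDl; apply: (besov_normB hLP); [exact: hu|exact: hv].
Qed.

Lemma holder_pathS T T' u : T' <= T -> hpath T u -> hpath T' u.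
Proof.
move=> TT [h1 h2 h3].
have sub : `]0, T'] `<=` `]0, T].
  move=> t /=; rewrite !in_itv/= => /andP[-> h]; exact: le_trans h TT.
split.
- by move=> t /andP[t0 tT]; apply: h1; rewrite t0 (le_trans tT).
- by move=> k; apply: measurable_funS (h2 k) => //; exact: measurable_itv.
- by move=> k; apply: measurable_funS (h3 k) => //; exact: measurable_itv.
Qed.

Lemma holder_pathD T u v : hpath T u -> hpath T v -> hpath T (u + v).
Proof.
move=> [u1 u2 u3] [v1 v2 v3]; split.
- by move=> t tT; apply: (holderD hLP); [exact: u1|exact: v1].
- move=> k; have := measurable_funD (u2 k) (v2 k); apply: eq_measurable_fun.
  by move=> t _; rewrite /= -ReD.
- move=> k; have := measurable_funD (u3 k) (v3 k); apply: eq_measurable_fun.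
  by move=> t _; rewrite /= -ImD.
Qed.

Lemma holder_pathB T u v : hpath T u -> hpath T v -> hpath T (u - v).
Proof.
move=> [u1 u2 u3] [v1 v2 v3]; split.
- by move=> t tT; apply: (holderB hLP); [exact: u1|exact: v1].
- move=> k; have := measurable_funB (u2 k) (v2 k); apply: eq_measurable_fun.
  by move=> t _; rewrite /= -ReN -ReD.
- move=> k; have := measurable_funB (u3 k) (v3 k); apply: eq_measurable_fun.
  by move=> t _; rewrite /= -ImN -ImD.
Qed.

Lemma holder_path0 T : hpath T 0.
Proof.
by split=> [t _|k|k]; [exact: (holder0 hLP)|exact: measurable_cst|exact: measurable_cst].
Qed.

Lemma bounded_path0 b T : bounded_path b 0 T 0.
Proof. by move=> t _; rewrite (besov_norm0 hLP) mul0r. Qed.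

(** A scalar majorant [f] of the product of norms supplies both the finiteness that [hV] requires
    and the final bound. *)
Lemma duhamel_estimate u v (f : R -> R) t (G : R) : 0 < t ->
  hpath t u -> hpath t v ->
  (forall s, 0 < s < t -> (bnorm (u s) * bnorm (v s) <= (f s)%:E)%E) ->
  (\int[mu]_(s in `]0%R, t[) ((t - s) `^ (- delta) * f s)%:E <= G%:E)%E ->
  [/\ duhamel_integrable S B u v t, hol (V u v t) & (bnorm (V u v t) <= (c * G)%:E)%E].
Proof.
move=> t0 hu hv uvf fG.
have I : (\int[mu]_(s in `]0%R, t[)
    (((t - s) `^ (- delta))%:E * (bnorm (u s) * bnorm (v s))) <= G%:E)%E.
  apply: le_trans fG; apply: ge0_le_lower_integral => s; rewrite /= in_itv/= => st.
    apply: mule_ge0; first by rewrite lee_fin powR_ge0.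
    by apply: mule_ge0; exact: besov_norm_ge0.
  rewrite EFinM; apply: lee_wpmul2l; first by rewrite lee_fin powR_ge0.
  exact: uvf.
have [|h1 h2 h3] := hV t0 hu hv; first by apply: le_lt_trans I _; exact: ltry.
split=> //; apply: le_trans h3 _; rewrite EFinM.
by apply: lee_wpmul2l => //; rewrite lee_fin ltW.
Qed.

(** Makes a Duhamel term an admissible argument of V again. Since t - s > 0 on the triangle, the
    semigroup is right continuous there even though B(u, v) is only a distribution. *)
Lemma duhamel_path u v T : 0 < T -> hpath T u -> hpath T v ->
  (forall t, 0 < t <= T -> duhamel_integrable S B u v t /\ hol (V u v t)) ->
  hpath T (V u v).
Proof.
move=> T0 hu hv huv.
have hBd s : 0 < s <= T -> periodic_distribution (B (u s) (v s)).
  by move=> sT; case: hB => + _ _; apply; [case: hu => + _ _|case: hv => + _ _]; exact.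
have cont k s t e : 0 < s < t -> t <= T -> 0 < e -> exists2 r, 0 < r &
    forall h, 0 < h < r ->
    cabs (S (t + h - s) (B (u s) (v s)) k - S (t - s) (B (u s) (v s)) k) <= e.
  move=> /andP[s0 st] tT e0.
  have [||r r0 hr] := semigroup_right_continuous hLP hA hS hsmooth k _ _ e0 (t := t - s) (u := B (u s) (v s)).
  - by rewrite subr_gt0.
  - by apply: hBd; rewrite s0 (le_trans (ltW st)).
  by exists r => // h /hr; rewrite addrAC.
split.
- by move=> t /huv[].
- move=> k; apply: (measurable_fun_triangle_integral
    (g := fun t s => complex.Re (S (t - s) (B (u s) (v s)) k)) T0).
    move=> t /huv[/(_ k)[+ _] _] => /measurable_int.
    by move=> /measurable_EFinP.
  move=> s t e st tT e0; have [r r0 hr] := cont k s t e st tT e0.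
  exists r => // h /hr; apply: le_trans.
  by apply: le_trans (Re_le_cabs _); rewrite ReD ReN.
- move=> k; apply: (measurable_fun_triangle_integral
    (g := fun t s => complex.Im (S (t - s) (B (u s) (v s)) k)) T0).
    move=> t /huv[/(_ k)[_ +] _] => /measurable_int.
    by move=> /measurable_EFinP.
  move=> s t e st tT e0; have [r r0 hr] := cont k s t e st tT e0.
  exists r => // h /hr; apply: le_trans.
  by apply: le_trans (Im_le_cabs _); rewrite ImD ImN.
Qed.

Lemma duhamelBl u w z t :
  (forall s, 0 < s < t -> [/\ hol (u s), hol (w s) & hol (z s)]) ->
  duhamel_integrable S B u z t -> duhamel_integrable S B w z t ->
  V (u - w) z t = V u z t - V w z t.
Proof.
move=> huwz iu iw.
have E k s : 0 < s < t -> S (t - s) (B ((u - w) s) (z s)) k =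
    S (t - s) (B (u s) (z s)) k - S (t - s) (B (w s) (z s)) k.
  move=> /[dup] st /huwz[us ws zs]; have /andP[_ ts] := st.
  case: hB => hd _ hl; case: hS => _ hSl _ _.
  have -> : (u - w) s = (-1) \*o w s + u s by rewrite scaleN1_fourier addrC.
  rewrite (hl _ zs) // (hSl (t - s)); [|by rewrite subr_ge0 ltW|exact: hd|exact: hd].
  by rewrite scaleN1_fourier addrC.
apply/funext => k; rewrite /duhamel.
have [iur iui] := iu k; have [iwr iwi] := iw k.
have -> : \int[mu]_(s in `]0, t[) complex.Re (S (t - s) (B ((u - w) s) (z s)) k)
    = \int[mu]_(s in `]0, t[) complex.Re (S (t - s) (B (u s) (z s)) k)
      - \int[mu]_(s in `]0, t[) complex.Re (S (t - s) (B (w s) (z s)) k).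
  rewrite -RintegralB//; apply: eq_Rintegral => s; rewrite inE /= in_itv /= => st.
  by rewrite E// ReD ReN.
have -> : \int[mu]_(s in `]0, t[) complex.Im (S (t - s) (B ((u - w) s) (z s)) k)
    = \int[mu]_(s in `]0, t[) complex.Im (S (t - s) (B (u s) (z s)) k)
      - \int[mu]_(s in `]0, t[) complex.Im (S (t - s) (B (w s) (z s)) k).
  rewrite -RintegralB//; apply: eq_Rintegral => s; rewrite inE /= in_itv /= => st.
  by rewrite E// ImD ImN.
by [].
Qed.

Lemma duhamelC u w t : (forall s, 0 < s < t -> hol (u s) /\ hol (w s)) ->
  V u w t = V w u t.
Proof.
move=> h; apply/funext => k; rewrite /duhamel; case: hB => _ hsym _.
congr (_ +i* _)%C; apply: eq_Rintegral => s; rewrite inE /= in_itv /= => /h[us ws];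
  by rewrite hsym.
Qed.

(** * The contraction estimate *)

Section small_data.
Variables (beta gamma : R) (hbd : beta + delta <= 1) (hdg : delta + gamma <= 1).
Variables eta1 eta2 : R -> fourier R d.

Definition mild_map v : R -> fourier R d :=
  fun t => V v v t + 2 \*o V v eta1 t + eta2 t.

Definition kernel_bound (theta K : R) : Prop := forall t M, 0 < t -> 0 <= M ->
  (\int[mu]_(s in `]0%R, t[) ((t - s) `^ (- delta) * (M * s `^ (- theta)))%:E
    <= (M * K * t `^ (1 - delta - theta))%:E)%E.

Lemma duhamel_bounded b b' K M M' u v t : kernel_bound (b + b') K ->
  0 <= M -> 0 <= M' -> 0 < t -> hpath t u -> hpath t v ->
  bounded_path b M t u -> bounded_path b' M' t v ->
  [/\ duhamel_integrable S B u v t, hol (V u v t) &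
    (bnorm (V u v t) <= (c * (M * M' * K * t `^ (1 - delta - (b + b'))))%:E)%E].
Proof.
move=> hK M0 M0' t0 hu hv bu bv.
apply: (duhamel_estimate t0 hu hv (f := fun s => M * M' * s `^ (- (b + b')))).
  move=> s /andP[s0 st]; have sT : 0 < s <= t by rewrite s0 ltW.
  apply: le_trans (lee_pmul _ _ (bu s sT) (bv s sT)) _; rewrite ?besov_norm_ge0//.
  rewrite -EFinM lee_fin opprD powRD; last by rewrite (gt_eqF s0) implybT.
  by rewrite le_eqVlt; apply/orP; left; apply/eqP; ring.
by apply: hK => //; rewrite mulr_ge0.
Qed.

Lemma scale2_fourier (x : fourier R d) : 2 \*o x = x + x.
Proof. by apply/funext => k; rewrite /= mulr_natl mulr2n. Qed.

Lemma holder_path_hol t u s : hpath t u -> 0 < s < t -> hol (u s).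
Proof. by case=> + _ _ => + /andP[s0 st]; apply; rewrite s0 ltW. Qed.

Variables K1 K2 : R.
Hypotheses (hK1 : kernel_bound (beta + beta) K1) (hK2 : kernel_bound (beta + gamma) K2).
Hypotheses (K10 : 0 < K1) (K20 : 0 < K2).

Lemma mild_map_sub N M t u w : 0 <= N -> 0 <= M -> 0 < t ->
  hpath t u -> hpath t w -> hpath t eta1 ->
  bounded_path beta N t u -> bounded_path beta N t w -> bounded_path gamma M t eta1 ->
  mild_map u t - mild_map w t =
    V (u - w) u t + V (u - w) w t + (V (u - w) eta1 t + V (u - w) eta1 t).
Proof.
move=> N0 M0 t0 hu hw h1 bu bw b1; rewrite /mild_map !scale2_fourier.
have holh u' : hpath t u' -> forall s, 0 < s < t -> hol (u' s).
  by move=> h s; exact: holder_path_hol.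
have int u' v' : hpath t u' -> hpath t v' -> bounded_path beta N t u' ->
    bounded_path beta N t v' -> duhamel_integrable S B u' v' t.
  by move=> hu' hv' bu' bv'; have [] := duhamel_bounded hK1 N0 N0 t0 hu' hv' bu' bv'.
have inte u' : hpath t u' -> bounded_path beta N t u' -> duhamel_integrable S B u' eta1 t.
  by move=> hu' bu'; have [] := duhamel_bounded hK2 N0 M0 t0 hu' h1 bu' b1.
(* Expanding the right-hand side leaves the cross terms V(u, w) and V(w, u), which cancel by
   symmetry. *)
rewrite !duhamelBl; try (by apply: int) ; try (by apply: inte);
  try (by move=> s st; split; exact: holh).
rewrite (@duhamelC w u); last by move=> s st; split; exact: holh.
by apply/funext => k; rewrite !fctE; ring.
Qed.

(** Here [N] bounds the two paths and [M] bounds [eta1]. The power of [T] is kept in the quadratic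
    term, where it gives smallness for large [N] if beta + delta < 1; in the linear term it is
    replaced by 1, smallness coming from [M]. *)
Definition contraction_factor (N M T : R) : R :=
  c * (2 * N * K1 * T `^ (1 - delta - beta) + 2 * M * K2).

Lemma mild_map_contraction N M D T u w : 0 <= N -> 0 <= M -> 0 <= D -> T <= 1 ->
  hpath T u -> hpath T w -> hpath T eta1 ->
  bounded_path beta N T u -> bounded_path beta N T w -> bounded_path gamma M T eta1 ->
  bounded_path beta D T (u - w) ->
  bounded_path beta (contraction_factor N M T * D) T (mild_map u - mild_map w).
Proof.
move=> N0 M0 D0 T1 hu hw h1 bu bw b1 bd t /[dup] tT /andP[t0 tT'].
have {}hu := holder_pathS tT' hu; have {}hw := holder_pathS tT' hw.
have {}h1 := holder_pathS tT' h1.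
have {}bu := bounded_path_le (lexx _) tT' bu; have {}bw := bounded_path_le (lexx _) tT' bw.
have {}b1 := bounded_path_le (lexx _) tT' b1; have {}bd := bounded_path_le (lexx _) tT' bd.
have hd := holder_pathB hu hw.
rewrite [X in bnorm X](_ : _ = mild_map u t - mild_map w t)//.
rewrite (mild_map_sub N0 M0 t0 hu hw h1 bu bw b1).
have [_ _ ex] := duhamel_bounded hK1 D0 N0 t0 hd hu bd bu.
have [_ _ ey] := duhamel_bounded hK1 D0 N0 t0 hd hw bd bw.
have [_ _ ez] := duhamel_bounded hK2 D0 M0 t0 hd h1 bd b1.
apply: le_trans (besov_normD hLP (besov_normD hLP ex ey) (besov_normD hLP ez ez)) _.
rewrite lee_fin /contraction_factor.
have tn0 : t != 0 by rewrite gt_eqF.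
have E b : t `^ (1 - delta - (beta + b)) = t `^ (1 - delta - b) * t `^ (- beta).
  by rewrite -powRD ?tn0 ?implybT//; congr (_ `^ _); ring.
rewrite !E.
(* The hypotheses [hbd] and [hdg] make the two exponents nonnegative, so the powers increase with
   time. *)
have p1 : t `^ (1 - delta - beta) <= T `^ (1 - delta - beta).
  apply: ge0_ler_powR => //; rewrite ?nnegrE ?(ltW t0)//.
    by rewrite -addrA -opprD subr_ge0 addrC.
  exact: le_trans (ltW t0) tT'.
have p2 : t `^ (1 - delta - gamma) <= 1.
  apply: (@le_trans _ _ (1 `^ (1 - delta - gamma))); last by rewrite powR1.
  apply: ge0_ler_powR; rewrite ?nnegrE ?(ltW t0)//.
    by rewrite -addrA -opprD subr_ge0.
  exact: le_trans T1.
set b := t `^ (- beta); have b0 : 0 <= b by exact: powR_ge0.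
rewrite [leLHS](_ : _ = (c * (2 * N * K1 * t `^ (1 - delta - beta) +
    2 * M * K2 * t `^ (1 - delta - gamma)) * D) * b); last by ring.
rewrite ler_wpM2r// ler_wpM2r// ler_pM2l// lerD//.
  by rewrite ler_wpM2l// !mulr_ge0// ltW.
by rewrite ler_piMr// !mulr_ge0// ltW.
Qed.

Lemma mild_map_path N M T v : 0 <= N -> 0 <= M -> 0 < T ->
  hpath T v -> hpath T eta1 -> hpath T eta2 ->
  bounded_path beta N T v -> bounded_path gamma M T eta1 ->
  hpath T (mild_map v).
Proof.
move=> N0 M0 T0 hv h1 h2 bv b1.
have -> : mild_map v = V v v + (V v eta1 + V v eta1) + eta2.
  by apply/funext => t; rewrite /mild_map scale2_fourier.
have P t : 0 < t <= T -> [/\ 0 < t, hpath t v, hpath t eta1,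
    bounded_path beta N t v & bounded_path gamma M t eta1].
  move=> /andP[t0 tT]; split=> //; [exact: holder_pathS hv|exact: holder_pathS h1|
    exact: bounded_path_le bv|exact: bounded_path_le b1].
have h11 : hpath T (V v eta1).
  apply: duhamel_path => // t /P[t0 hv' h1' bv' b1'].
  by have [] := duhamel_bounded hK2 N0 M0 t0 hv' h1' bv' b1'.
apply: holder_pathD => //; apply: holder_pathD; last exact: holder_pathD.
apply: duhamel_path => // t /P[t0 hv' h1' bv' b1'].
by have [] := duhamel_bounded hK1 N0 N0 t0 hv' hv' bv' bv'.
Qed.

(** * Picard iteration in the ball of radius [eps] *)

Section picard.
Variables (T M M2 eps : R).
Hypotheses (T0 : 0 < T) (T1 : T <= 1) (M0 : 0 <= M) (eps0 : 0 < eps).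
Hypotheses (h1 : hpath T eta1) (h2 : hpath T eta2).
Hypotheses (b1 : bounded_path gamma M T eta1) (b2 : bounded_path beta M2 T eta2).
Hypotheses (hM2 : M2 <= eps / 2) (hq : contraction_factor eps M T <= 2^-1).

Lemma mild_map_contraction_half D u w : 0 <= D -> hpath T u -> hpath T w ->
  bounded_path beta eps T u -> bounded_path beta eps T w ->
  bounded_path beta D T (u - w) ->
  bounded_path beta (D / 2) T (mild_map u - mild_map w).
Proof.
move=> D0 hu hw bu bw bd.
apply: bounded_path_le (mild_map_contraction (ltW eps0) M0 D0 T1 hu hw h1 bu bw b1 bd) => //.
by rewrite [leRHS]mulrC ler_wpM2r.
Qed.

Lemma mild_map0 t : 0 < t <= T -> mild_map 0 t = eta2 t.
Proof.
move=> /andP[t0 tT].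
have h0 : hpath t 0 := holder_path0 t; have hb := @bounded_path0 beta t.
have h1' := holder_pathS tT h1; have b1' := bounded_path_le (lexx _) tT b1.
have [i0 _ _] := duhamel_bounded hK1 (lexx 0) (lexx 0) t0 h0 h0 hb hb.
have [i1 _ _] := duhamel_bounded hK2 (lexx 0) M0 t0 h0 h1' hb b1'.
have E z : hpath t z -> duhamel_integrable S B 0 z t -> V 0 z t = 0.
  (* Additivity applied to 0 = 0 - 0 gives V(0, z) = V(0, z) - V(0, z). *)
  move=> hz hi; have := @duhamelBl 0 0 z t _ hi hi; rewrite !subrr; apply.
  by move=> s st; split; [exact: (holder_path_hol h0)|exact: (holder_path_hol h0)|exact: (holder_path_hol hz)].
by rewrite /mild_map scale2_fourier !E// !add0r.
Qed.

(** The image of 0 is [eta2], of size at most eps/2, and the contraction puts the image of [v]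
    within eps/2 of it. *)
Lemma mild_map_ball v : hpath T v -> bounded_path beta eps T v ->
  bounded_path beta eps T (mild_map v).
Proof.
move=> hv bv t tT.
have b0 : bounded_path beta eps T 0.
  by apply: bounded_path_le (@bounded_path0 beta T) => //; exact: ltW.
have bv0 : bounded_path beta eps T (v - 0) by rewrite subr0.
have := mild_map_contraction_half (ltW eps0) hv (holder_path0 T) bv b0 bv0.
move=> /(_ t tT) hb.
have -> : mild_map v t = (mild_map v - mild_map 0) t + eta2 t.
  by rewrite -mild_map0// subrK.
apply: le_trans (besov_normD hLP hb (b2 tT)) _.
by rewrite lee_fin -mulrDl ler_wpM2r ?powR_ge0//; have := hM2; lra.
Qed.

Definition picard n : R -> fourier R d := iter n mild_map 0.

Lemma picard_ball n : hpath T (picard n) /\ bounded_path beta eps T (picard n).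
Proof.
elim: n => [|n [IH1 IH2]].
  split; first exact: holder_path0.
  by apply: bounded_path_le (@bounded_path0 beta T) => //; exact: ltW.
split; last exact: mild_map_ball.
by apply: mild_map_path IH1 h1 h2 IH2 b1 => //; exact: ltW.
Qed.

Lemma picard_step n : bounded_path beta (eps / 2 ^+ n) T (picard n.+1 - picard n).
Proof.
elim: n => [|n IH].
  by rewrite expr0 divr1 subr0; exact: (picard_ball 1).2.
rewrite exprSr invfM mulrA; apply: mild_map_contraction_half => //.
- by rewrite divr_ge0// ltW.
- exact: (picard_ball n.+1).1.
- exact: (picard_ball n).1.
- exact: (picard_ball n.+1).2.
- exact: (picard_ball n).2.
Qed.

Lemma picard_cauchy n m :
  bounded_path beta (2 * eps / 2 ^+ n) T (picard (n + m) - picard n).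
Proof.
(* The exact geometric sum telescopes, which the weaker bound does not. *)
suff : bounded_path beta (2 * eps / 2 ^+ n - 2 * eps / 2 ^+ (n + m)) T
    (picard (n + m) - picard n).
  by apply: bounded_path_le => //; rewrite gerBl divr_ge0// mulr_ge0// ltW.
elim: m => [|m IH].
  by rewrite addn0 !subrr; exact: bounded_path0.
have -> : picard (n + m.+1) - picard n =
    (picard (n + m).+1 - picard (n + m)) + (picard (n + m) - picard n).
  by rewrite addnS addrA subrK.
move=> t tT; apply: le_trans (besov_normD hLP (picard_step (n + m) tT) (IH t tT)) _.
rewrite lee_fin -mulrDl ler_wpM2r ?powR_ge0// addnS exprS.
have p0 : 2 ^+ (n + m) != 0 :> R by rewrite expf_neq0.
rewrite le_eqVlt; apply/orP; left; apply/eqP.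
by field; rewrite p0 expf_neq0.
Qed.

(** Taken coefficient by coefficient, so that measurability in time passes to the limit; convergence
    is established on ]0, T]. *)
Definition picard_limit : R -> fourier R d := fun t k =>
  (limn (fun n => complex.Re (picard n t k)) +i*
   limn (fun n => complex.Im (picard n t k)))%C.

Lemma picard_cvg t k : 0 < t <= T ->
  (fun n => complex.Re (picard n t k)) @ \oo --> complex.Re (picard_limit t k) /\
  (fun n => complex.Im (picard n t k)) @ \oo --> complex.Im (picard_limit t k).
Proof.
move=> tT; have [C C0 hC] := coef_le_besov_norm hLP alpha.
pose e n := C * (2 * eps * t `^ (- beta)) * bracket R k `^ (- alpha) / 2 ^+ n.
have E n m : cabs (picard (n + m) t k - picard n t k) <= e n.
  have := hC _ k _ (picard_cauchy n m tT); rewrite !fctE => /le_trans; apply.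
  by rewrite /e le_eqVlt; apply/orP; left; apply/eqP; ring.
split.
  apply: (@cvgn_of_modulus _ _ e); last exact: geometric_cvg0.
  by move=> n m; apply: le_trans (E n m); rewrite -ReN -ReD Re_le_cabs.
apply: (@cvgn_of_modulus _ _ e); last exact: geometric_cvg0.
by move=> n m; apply: le_trans (E n m); rewrite -ImN -ImD Im_le_cabs.
Qed.

Lemma picard_coef_cvg t k : 0 < t <= T ->
  (fun n => cabs (picard n t k - picard_limit t k)) @ \oo --> (0 : R).
Proof.
move=> /(picard_cvg k)[hr hi].
apply: (@squeeze_cvgr _ _ _ _ (fun=> 0)
  (fun n => `|complex.Re (picard n t k) - complex.Re (picard_limit t k)| +
            `|complex.Im (picard n t k) - complex.Im (picard_limit t k)|)).
- apply: nearW => n; rewrite cabs_ge0 /=.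
  by apply: le_trans (cabs_le_ReIm _) _; rewrite ReD ReN ImD ImN.
- exact: cvg_cst.
- rewrite -[X in _ --> X]addr0; apply: cvgD.
    by apply/norm_cvg0P/subr_cvg0; exact: hr.
  by apply/norm_cvg0P/subr_cvg0; exact: hi.
Qed.

Lemma picard_limit_dist n :
  bounded_path beta (2 * eps / 2 ^+ n) T (picard_limit - picard n).
Proof.
move=> t tT; apply: (besov_norm_lsc hLP (v := fun m => (picard (n + m) - picard n) t)).
  move=> k; rewrite [X in X @ _](_ : _ =
    (fun m => cabs (picard (m + n) t k - picard_limit t k))); last first.
    by apply/funext => m; rewrite addnC !fctE; congr cabs; ring.
  by have := picard_coef_cvg k tT; rewrite -(cvg_shiftn n).
by move=> m; exact: picard_cauchy.
Qed.

Lemma picard_limit_bounded : bounded_path beta eps T picard_limit.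
Proof.
move=> t tT; apply: (besov_norm_lsc hLP (v := fun n => picard n t)).
  by move=> k; exact: picard_coef_cvg.
by move=> n; exact: (picard_ball n).2.
Qed.

Lemma besov_norm_geometric_eq0 C (x : fourier R d) :
  (forall n, (bnorm x <= (C / 2 ^+ n)%:E)%E) -> x = 0.
Proof.
move=> h; apply: (besov_norm_eq0 hLP (a := alpha)).
apply/lee_addgt0Pr => e e0; have [n hn] := geometric_small C e0.
by apply: le_trans (h n) _; rewrite add0e lee_fin.
Qed.

Lemma picard_limit_path : hpath T picard_limit.
Proof.
split.
- move=> t tT; apply: (holder_closed hLP) => e e0.
  have [n hn] := geometric_small (2 * eps * t `^ (- beta)) e0.
  exists (picard n t); first by case: (picard_ball n) => -[+ _ _] _; exact.
  apply: le_trans (picard_limit_dist n tT) _; rewrite lee_fin; apply: le_trans hn.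
  by rewrite mulrAC.
- move=> k; apply: (@measurable_fun_cvg _ _ _ _ (fun n t => complex.Re (picard n t k))).
    by move=> n; case: (picard_ball n) => -[_ + _] _; exact.
  by move=> t; rewrite /= in_itv /= => tT; exact: (picard_cvg k tT).1.
- move=> k; apply: (@measurable_fun_cvg _ _ _ _ (fun n t => complex.Im (picard n t k))).
    by move=> n; case: (picard_ball n) => -[_ _ +] _; exact.
  by move=> t; rewrite /= in_itv /= => tT; exact: (picard_cvg k tT).2.
Qed.

(** With F the mild map, v - F(v) = (v - v_{n+1}) - (F(v) - F(v_n)), and both differences decay
    geometrically. *)
Lemma picard_limit_fixed t : 0 < t <= T -> picard_limit t = mild_map picard_limit t.
Proof.
move=> tT; apply/eqP; rewrite -subr_eq0; apply/eqP.
apply: (@besov_norm_geometric_eq0 (2 * eps * t `^ (- beta))) => n.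
have D0 : 0 <= 2 * eps / 2 ^+ n by rewrite divr_ge0// mulr_ge0// ltW.
have hm := mild_map_contraction_half D0 picard_limit_path (picard_ball n).1
  picard_limit_bounded (picard_ball n).2 (@picard_limit_dist n).
have -> : picard_limit t - mild_map picard_limit t =
   (picard_limit - picard n.+1) t - (mild_map picard_limit - mild_map (picard n)) t.
  rewrite (_ : picard n.+1 = mild_map (picard n))//.
  by apply/funext => k; rewrite !fctE; ring.
apply: le_trans (besov_normB hLP (picard_limit_dist n.+1 tT) (hm t tT)) _.
rewrite lee_fin exprS le_eqVlt; apply/orP; left; apply/eqP; field.
by rewrite expf_neq0.
Qed.

End picard.

(** * Uniqueness near 0 and its continuation in time *)

Lemma mild_unique_small N M T u w : 0 <= N -> 0 <= M -> T <= 1 ->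
  hpath T u -> hpath T w -> hpath T eta1 ->
  bounded_path beta N T u -> bounded_path beta N T w -> bounded_path gamma M T eta1 ->
  contraction_factor N M T <= 2^-1 ->
  (forall t, 0 < t <= T -> u t = mild_map u t) ->
  (forall t, 0 < t <= T -> w t = mild_map w t) ->
  forall t, 0 < t <= T -> u t = w t.
Proof.
move=> N0 M0 T1 hu hw h1 bu bw b1 hq eu ew t tT.
have bd n : bounded_path beta ((N + N) / 2 ^+ n) T (u - w).
  elim: n => [|n IH]; first by rewrite expr0 divr1; exact: bounded_pathB.
  have D0 : 0 <= (N + N) / 2 ^+ n by rewrite divr_ge0// addr_ge0.
  move=> s sT; have -> : (u - w) s = (mild_map u - mild_map w) s.
    by rewrite !fctE -eu// -ew.
  apply: bounded_path_le (mild_map_contraction N0 M0 D0 T1 hu hw h1 bu bw b1 IH) s sT => //.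
  by rewrite exprSr invfM [leRHS]mulrA [leRHS]mulrC ler_wpM2r.
apply/eqP; rewrite -subr_eq0; apply/eqP.
apply: (@besov_norm_geometric_eq0 ((N + N) * t `^ (- beta))) => n.
by apply: le_trans (bd n t tT) _; rewrite lee_fin mulrAC.
Qed.

(* Once u = w up to time tau, the difference only sees the kernel (t-s)^-delta on
   ]tau, t], so the Duhamel map is a contraction for it on a time step whose
   length depends only on the bounds on [T0, T]. *)
Lemma mild_continuation N M T0 T u w : 0 <= N -> 0 <= M -> 0 < T0 <= T ->
  hpath T u -> hpath T w -> hpath T eta1 ->
  bounded_path beta N T u -> bounded_path beta N T w -> bounded_path gamma M T eta1 ->
  (forall t, 0 < t <= T -> u t = mild_map u t) ->
  (forall t, 0 < t <= T -> w t = mild_map w t) ->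
  (forall t, 0 < t <= T0 -> u t = w t) ->
  forall t, 0 < t <= T -> u t = w t.
Proof.
move=> N0 M0 /andP[T00 T0T] hu hw h1 bu bw b1 eu ew e0.
pose X b := T0 `^ (- b) + T `^ (- b).
have XP b s : T0 <= s <= T -> s `^ (- b) <= X b.
  move=> /andP[s1 s2]; have TT := lt_le_trans T00 T0T.
  have := powR_sandwich (q := 1) (y := s) (- b) T00 TT ltr01.
  by rewrite !mulr1 s1 s2 powR1 mulr1; apply.
have X0 b : 0 <= X b by rewrite addr_ge0 ?powR_ge0.
(* A common bound for u, w and eta1 on [T0, T]; away from 0 the time weights reduce to constants. *)
pose A' := N * X beta + M * X gamma.
have A0 : 0 <= A' by rewrite addr_ge0// mulr_ge0.
have bA b L v : 0 <= L -> L * X b <= A' -> bounded_path b L T v ->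
    forall s, T0 <= s <= T -> (bnorm (v s) <= A'%:E)%E.
  move=> L0 LA bv s /[dup] sT /andP[s1 s2].
  apply: le_trans (bv s _) _; first by rewrite (lt_le_trans T00).
  by rewrite lee_fin; apply: le_trans LA; rewrite ler_wpM2l// XP.
have NA : N * X beta <= A' by rewrite lerDl mulr_ge0.
have MA : M * X gamma <= A' by rewrite lerDr mulr_ge0.
have uA := bA _ _ _ N0 NA bu; have wA := bA _ _ _ N0 NA bw.
have eA := bA _ _ _ M0 MA b1.
have /andP[_ delta1] := hdelta; have p0 : 0 < 1 - delta by rewrite subr_gt0.
(* A step [h] with h^(1 - delta) below this number bounds each of the four Duhamel terms by D/8,
   hence their sum by D/2. The added 1 avoids division by zero when A' = 0. *)
have x0 : 0 < (1 - delta) / (8 * c * (A' + 1)).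
  by rewrite divr_gt0// mulr_gt0 ?mulr_gt0// ltr_wpDl.
have [h /andP[h0 _] hx] := powR_small p0 x0 ltr01.
have step a : T0 <= a -> (forall t, 0 < t <= a -> t <= T -> u t = w t) ->
    forall t, 0 < t <= a + h -> t <= T -> u t = w t.
  move=> T0a ea t /andP[t0 tah] tT.
  have [ta|ta] := leP t a; first by apply: ea => //; rewrite t0.
  have a00 := lt_le_trans T00 T0a.
  suff bd n : forall s, a < s <= a + h -> s <= T ->
      (bnorm (u s - w s) <= ((A' + A') / 2 ^+ n)%:E)%E.
    apply/eqP; rewrite -subr_eq0; apply/eqP.
    apply: (@besov_norm_geometric_eq0 (A' + A')) => n.
    by apply: bd => //; rewrite ta.
  elim: n => [|n IH] s /andP[as_ sh] sT.
    rewrite expr0 divr1; apply: (besov_normB hLP); [apply: uA|apply: wA];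
      by rewrite sT andbT; apply: le_trans T0a (ltW as_).
  set D := (A' + A') / 2 ^+ n; have D0 : 0 <= D by rewrite divr_ge0// addr_ge0.
  have s0 : 0 < s := lt_trans a00 as_; have s0T : 0 < s <= T by rewrite s0.
  have hu' := holder_pathS sT hu; have hw' := holder_pathS sT hw.
  have h1' := holder_pathS sT h1; have hd := holder_pathB hu' hw'.
  rewrite (eu _ s0T) (ew _ s0T) (mild_map_sub N0 M0 s0 hu' hw' h1'
    (bounded_path_le (lexx _) sT bu) (bounded_path_le (lexx _) sT bw)
    (bounded_path_le (lexx _) sT b1)).
  have est v : hpath s v -> (forall r, T0 <= r <= T -> (bnorm (v r) <= A'%:E)%E) ->
      (bnorm (V (u - w)%R v s) <= (D / 8)%:E)%E.
    move=> hv vA.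
    have [||_ _ ] := duhamel_estimate s0 hd hv
      (f := fun r => if r <= a then 0 else D * A')
      (G := D * A' * ((s - a) `^ (1 - delta) / (1 - delta))).
    - move=> r /andP[r0 rs]; have rT : r <= T := le_trans (ltW rs) sT.
      have [ra|ra] := leP r a.
        rewrite (_ : (u - w) r = 0); first by rewrite (besov_norm0 hLP) mul0e.
        have era : u r = w r by apply: ea rT; rewrite r0.
        by rewrite (_ : (u - w) r = u r - w r)// era subrr.
      rewrite EFinM; apply: lee_pmul; rewrite ?besov_norm_ge0//.
        by apply: IH => //; rewrite ra (le_trans (ltW rs)).
      by apply: vA; rewrite rT andbT; apply: le_trans T0a (ltW ra).
    - by apply: integral_tail_kernel => //; [rewrite (ltW a00)|rewrite mulr_ge0].
    move=> h2; apply: le_trans h2 _; rewrite lee_fin.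
    have sah : (s - a) `^ (1 - delta) <= (1 - delta) / (8 * c * (A' + 1)).
      apply: le_trans hx; apply: ge0_ler_powR; rewrite ?nnegrE ?(ltW p0) ?(ltW h0)//.
        by rewrite subr_ge0 ltW.
      by rewrite lerBlDl.
    apply: (@le_trans _ _ (c * (D * A' * ((1 - delta) / (8 * c * (A' + 1)) / (1 - delta))))).
      rewrite ler_pM2l//; apply: ler_wpM2l; first by rewrite mulr_ge0.
      by rewrite ler_pM2r ?invr_gt0.
    have A1 : 0 < A' + 1 by rewrite ltr_wpDl.
    rewrite (_ : c * _ = D / 8 * (A' / (A' + 1))); last first.
      by field; rewrite !gt_eqF.
    apply: ler_piMr; first by rewrite divr_ge0.
    by rewrite ler_pdivrMr// mul1r lerDl.
  have ex := est _ hu' (fun r h => uA r h); have ey := est _ hw' (fun r h => wA r h).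
  have ez := est _ h1' (fun r h => eA r h).
  apply: le_trans (besov_normD hLP (besov_normD hLP ex ey) (besov_normD hLP ez ez)) _.
  rewrite lee_fin exprS le_eqVlt; apply/orP; left; apply/eqP.
  by rewrite /D; field; rewrite expf_neq0.
have all n : forall t, 0 < t <= T0 + n%:R * h -> t <= T -> u t = w t.
  elim: n => [|n IH]; first by rewrite mul0r addr0 => t t1 _; exact: e0.
  have hT : T0 <= T0 + n%:R * h by rewrite lerDl mulr_ge0// ltW.
  have := step _ hT IH; rewrite -addrA -[X in _ + (_ + X)]mul1r -mulrDl natr1.
  exact.
move=> t /andP[t0 tT]; apply: (all (Num.truncn (t / h)).+1) => //.
rewrite t0 /=; apply: ler_wpDl; first exact: ltW.
by rewrite -ler_pdivrMr// ltW// truncnS_gt.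
Qed.

End small_data.

End mild_solutions.

(** * Choice of the constants and conclusion *)

Lemma path_vanishing_small (R : realType) (d : nat) (chi rho : 'rV[R]_d -> R)
    (a b : R) (u : R -> fourier R d) (M : R) : 0 < M ->
  path_vanishing chi rho a b u -> \forall T \near (0 : R)^'+,
    path_space chi rho a b T u /\ bounded_path chi rho a b M T u.
Proof.
move=> M0 [hu u0].
have h : \forall T \near (0 : R)^'+, (path_norm chi rho a b T u < M%:E)%E.
  have : nbhs (0%E : \bar R) [set y | (y < M%:E)%E].
    by apply: open_ereal_lt'; rewrite lte_fin.
  by move=> /u0.
near=> T; split; first by near: T.
by apply/path_norm_leP/ltW; near: T.
Unshelve. all: by end_near. Qed.

Theorem theorem3p8 (R : realType) (d : nat) (hd : (0 < d)%N)
  (chi rho : 'rV[R]_d -> R) (hLP : dyadic_partition chi rho)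
  (* the operator A, its analytic semigroup S t = e^{tA}, and smoothing *)
  (a0 : R) (DA : set (fourier R d)) (A : fourier R d -> fourier R d)
  (S : R -> fourier R d -> fourier R d)
  (hA : generates_analytic_semigroup chi rho a0 DA A S)
  (hS : distribution_semigroup S)
  (tau : R) (htau : 0 < tau) (hsmooth : smoothing chi rho tau S)
  (* the bilinear operator B and the bound on V = duhamel S B *)
  (alpha delta c : R) (hdelta : 0 <= delta < 1) (hc : 0 < c)
  (B : fourier R d -> fourier R d -> fourier R d)
  (hB : symmetric_bilinear_on (holder chi rho alpha) B)
  (hV : duhamel_bound chi rho alpha delta c S B)
  (* exponents *)
  (beta gamma : R) (hbeta : beta < 2^-1) (hbd : beta + delta <= 1)
  (hgb : gamma + beta < 1) (hdg : delta + gamma <= 1)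
  (* data *)
  (u0 : fourier R d) (hu0 : periodic_distribution u0)
  (eta1 eta2 : R -> fourier R d)
  (heta1 : eta1 = fun t => S t u0)
  (hint : \forall T \near (0 : R)^'+, duhamel_integrable S B eta1 eta1 T)
  (heta2 : eta2 = duhamel S B eta1 eta1)
  (hvan1 : path_vanishing chi rho alpha gamma eta1)
  (hvan2 : path_vanishing chi rho alpha beta eta2) :
  exists T : R, 0 < T /\
  exists epsilon : R, 0 < epsilon /\
  exists v : R -> fourier R d,
    [/\ path_space chi rho alpha beta T v,
        solves S B eta1 eta2 T v,
        (path_norm chi rho alpha beta T v <= epsilon%:E)%E &
        (* uniqueness: in all of X^{alpha,beta}_T if beta + delta < 1, and,
           in the critical case beta + delta = 1, among the solutions whose
           norm is at most epsilon on some initial interval ]0, T'] *)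
        forall w : R -> fourier R d,
          path_space chi rho alpha beta T w ->
          solves S B eta1 eta2 T w ->
          beta + delta < 1 \/
          (exists T' : R, 0 < T' <= T /\
             (path_norm chi rho alpha beta T' w <= epsilon%:E)%E) ->
          forall t : R, 0 < t <= T -> w t = v t].
Proof.
have [K1 K10 hK1] : exists2 K, 0 < K & kernel_bound delta (beta + beta) K.
  by apply: integral_beta_kernel => //; lra.
have [K2 K20 hK2] : exists2 K, 0 < K & kernel_bound delta (beta + gamma) K.
  by apply: integral_beta_kernel => //; lra.
(* Each of the two terms of the contraction factor becomes at most 1/4 for every T <= 1, including
   in the critical case. *)
pose eps := (8 * c * K1)^-1; have eps0 : 0 < eps by rewrite invr_gt0 !mulr_gt0.
pose M := (8 * c * K2)^-1; have M0 : 0 < M by rewrite invr_gt0 !mulr_gt0.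
have eps2 : 0 < eps / 2 by rewrite divr_gt0.
have [T [T0 T1 [[h1 _] b1] [[h2 _] b2]]] : exists T : R, [/\ 0 < T, T <= 1,
    path_space chi rho alpha gamma T eta1 /\ bounded_path chi rho alpha gamma M T eta1 &
    path_space chi rho alpha beta T eta2 /\ bounded_path chi rho alpha beta (eps / 2) T eta2].
  near (0 : R)^'+ => T; exists T; split.
  - by near: T; exact: nbhs_right_gt.
  - by near: T; exact: nbhs_right_le.
  - by near: T; exact: path_vanishing_small hvan1.
  - by near: T; exact: path_vanishing_small hvan2.
have hq s : 0 < s <= 1 -> contraction_factor delta c beta K1 K2 eps M s <= 2^-1.
  move=> /andP[s0 s1]; have p1 : s `^ (1 - delta - beta) <= 1.
    apply: (@le_trans _ _ (1 `^ (1 - delta - beta))); last by rewrite powR1.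
    by apply: ge0_ler_powR; rewrite ?nnegrE ?(ltW s0)//; lra.
  apply: (@le_trans _ _ (c * (2 * eps * K1 + 2 * M * K2))).
    by rewrite ler_pM2l// lerD2r ler_piMr// !mulr_ge0// ltW.
  rewrite le_eqVlt; apply/orP; left; apply/eqP; rewrite /eps /M; field.
  by rewrite !gt_eqF.
have hT : 0 < T <= 1 by rewrite T0.
set v := picard_limit S B eta1 eta2.
have hv : holder_path chi rho alpha T v.
  exact: (picard_limit_path hLP hA hS hsmooth hc hB hV hbd hdg hK1 hK2 K10 K20
    T0 T1 (ltW M0) eps0 h1 h2 b1 b2 (lexx _) (hq _ hT)).
have bv : bounded_path chi rho alpha beta eps T v.
  exact: (picard_limit_bounded hLP hA hS hsmooth hc hB hV hbd hdg hK1 hK2 K10 K20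
    T0 T1 (ltW M0) eps0 h1 h2 b1 b2 (lexx _) (hq _ hT)).
have ev : solves S B eta1 eta2 T v.
  exact: (picard_limit_fixed hLP hA hS hsmooth hc hB hV hbd hdg hK1 hK2 K10 K20
    T0 T1 (ltW M0) eps0 h1 h2 b1 b2 (lexx _) (hq _ hT)).
exists T; split=> //; exists eps; split=> //; exists v; split=> //.
- exact: bounded_path_space bv.
- exact/path_norm_leP.
move=> w /path_space_bounded[hw [N N0 bw]] ew hcase.
(* Agreement on some initial interval is enough, by continuation; the two cases differ only in how
   that interval is found. *)
suff [T' T'T eT'] : exists2 T' : R, 0 < T' <= T &
    forall t, 0 < t <= T' -> w t = v t.
  apply: (mild_continuation hLP hS hdelta hc hB hV hK1 hK2 (N := Num.max N eps) _
    (ltW M0) T'T hw hv h1 _ _ b1 ew ev eT').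
  - by rewrite le_max N0.
  - by apply: bounded_path_le bw; rewrite // le_max lexx.
  - by apply: bounded_path_le bv; rewrite // le_max lexx orbT.
have small L T' : 0 <= L -> 0 < T' <= T -> bounded_path chi rho alpha beta L T' w ->
    bounded_path chi rho alpha beta L T' v ->
    contraction_factor delta c beta K1 K2 L M T' <= 2^-1 ->
    exists2 T' : R, 0 < T' <= T & forall t, 0 < t <= T' -> w t = v t.
  move=> L0 /[dup] hT' /andP[T'0 T'T] bw' bv' hq'; exists T' => //.
  have sol u : solves S B eta1 eta2 T u -> solves S B eta1 eta2 T' u.
    by move=> hu t /andP[t0 tT']; apply: hu; rewrite t0 (le_trans tT').
  apply: (mild_unique_small hLP hS hc hB hV hbd hdg hK1 hK2 K10 K20 L0 (ltW M0)
    (le_trans T'T T1) (holder_pathS T'T hw) (holder_pathS T'T hv)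
    (holder_pathS T'T h1) bw' bv' (bounded_path_le (lexx _) T'T b1) hq').
    exact: sol ew.
  exact: sol ev.
case: hcase => [hlt|[T' [hT' /path_norm_leP bw']]]; last first.
  have /andP[T'0 T'T] := hT'.
  apply: (small eps T') => //; first exact: ltW.
    exact: bounded_path_le bv.
  by apply: hq; rewrite T'0 (le_trans T'T).
(* In the subcritical case [L] bounds both solutions without being small. The interval is shortened
   until T'^(1 - delta - beta) <= 1/(8 c L K1), which brings the quadratic part of the factor down
   to 1/4. *)
pose L := Num.max N eps.
have L0 : 0 < L by rewrite lt_max eps0 orbT.
have x0 : 0 < (8 * c * L * K1)^-1 by rewrite invr_gt0 !mulr_gt0.
have p0 : 0 < 1 - delta - beta by lra.
have [T' T'T hx] := powR_small p0 x0 T0.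
have /andP[_ T'le] := T'T.
apply: (small L T') => //; first exact: ltW.
- by apply: bounded_path_le bw; rewrite // le_max lexx.
- by apply: bounded_path_le bv; rewrite // le_max lexx orbT.
rewrite /contraction_factor.
apply: (@le_trans _ _ (c * (2 * L * K1 * (8 * c * L * K1)^-1 + 2 * M * K2))).
  rewrite ler_pM2l// lerD2r ler_wpM2l// !mulr_ge0// ltW//.
rewrite le_eqVlt; apply/orP; left; apply/eqP; rewrite /M; field.
by rewrite !gt_eqF.
Unshelve. all: by end_near. Qed.
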